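(* Let $\{f_\theta,\ \theta\in\Theta\}$, $\Theta\subset\mathbb{R}^D$, be a parametric family of densities of $k$-dimensional simple max-stable distributions, and denote by $V_\theta$ the exponent function associated to $f_\theta$. Let $\theta_0\in\mathrm{int}(\Theta)$ and assume that there is a neighborhood $\Theta_0\subset\Theta$ of $\theta_0$ such that the following conditions hold: (A1) the density support $S_\theta=\{z\in(0,\infty)^k: f_\theta(z)>0\}$ does not depend on $\theta\in\Theta_0$; (A2) the derivative $(\theta,z)\in\Theta_0\times(0,\infty)^k\mapsto\partial_\theta\partial_{\{1,\ldots,k\}}V_\theta(z)$ exists and is continuous; (A3) for all $\theta\in\Theta_0$, all $z\in(0,\infty)^k$ with $\|z\|=1$ and all nonempty $\tau\subset\{1,\ldots,k\}$, $$\|\partial_\theta\log V_\theta(z)\|_\infty\le c(z)\quad\text{and}\quad\|\partial_\theta\log\partial_\tau V_\theta(z)\|_\infty\le c(z),$$ where $c(z)=A\sum_{i=1}^k z_i^{-\alpha}$ for some $A>0$ and $\alpha\in[0,1/2)$ (not depending on $\theta$, $z$, $\tau$), and $\|\cdot\|$ is an arbitrary norm on $\mathbb{R}^k$. Then the model $\{f_\theta,\ \theta\in\Theta\}$ is differentiable in quadratic mean at $\theta_0$ with score function $\dot\ell_{\theta_0}=\partial_\theta\log f_{\theta_0}$.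
   Context: A random vector $Z=(Z_1,\dots,Z_k)$ is simple max-stable if $\mathbb{P}(Z_i\le z)=\exp(-1/z)$ for $z>0$ and every $i$ and, for every $n\ge1$, the componentwise maximum of $n$ independent copies of $Z$ has the same distribution as $nZ$. Its exponent function is $V(z)=-\log F(z)$, $z\in(0,\infty)^k$, where $F$ is its distribution function. For nonempty $\tau\subset\{1,\dots,k\}$, $\partial_\tau V$ is the partial derivative of $V$ with respect to the variables $z_i$, $i\in\tau$, once each. The density is $f_\theta(z)=\sum_{\tau\in\mathscr{P}_k}\exp\{-V_\theta(z)\}\prod_{j=1}^{|\tau|}\{-\partial_{\tau_j}V_\theta(z)\}$ for $z\in(0,\infty)^k$, where $\mathscr{P}_k$ is the set of all partitions $\tau=\{\tau_1,\dots,\tau_{|\tau|}\}$ of $\{1,\dots,k\}$, and $f_\theta=0$ outside $(0,\infty)^k$. $\partial_\theta$ denotes the gradient with respect to $\theta$, and $\partial_\theta\log\partial_\tau V_\theta$ stands for $(\partial_\theta\partial_\tau V_\theta)/\partial_\tau V_\theta$. The model is differentiable in quadratic mean at $\theta_0\in\mathrm{int}(\Theta)$ if there is a measurable function $\dot\ell_{\theta_0}:\mathbb{R}^k\to\mathbb{R}^D$ (the score function) such that $$\int_{\mathbb{R}^k}\Big(\sqrt{f_{\theta_0+h}(z)}-\sqrt{f_{\theta_0}(z)}-\tfrac12 h^T\dot\ell_{\theta_0}(z)\sqrt{f_{\theta_0}(z)}\Big)^2\mathrm{d}z=o(\|h\|^2),\quad h\to0.$$ *)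

(* Defs.v *)
From HB Require Import structures.
From mathcomp Require Import all_boot all_order all_algebra.
From mathcomp Require Import all_classical all_reals all_analysis.

Set Implicit Arguments.
Unset Strict Implicit.
Unset Printing Implicit Defensive.
Import Order.TTheory GRing.Theory Num.Theory.
Import numFieldNormedType.Exports.

Local Open Scope classical_set_scope.
Local Open Scope ring_scope.

Definition row_display : measure_display -> measure_display.
Proof. exact. Qed.

Section measurable_row.
Context {d} {T : sigmaRingType d}.
Variable n : nat.

Let coors : 'I_n -> 'rV[T]_n -> T := fun i x => x ord0 i.

Let row_set0 : g_sigma_preimage coors set0.
Proof. exact: sigma_algebra0. Qed.

Let row_setC A : g_sigma_preimage coors A -> g_sigma_preimage coors (~` A).
Proof. exact: sigma_algebraC. Qed.

Let row_bigcup (F : _^nat) : (forall i, g_sigma_preimage coors (F i)) ->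
  g_sigma_preimage coors (\bigcup_i (F i)).
Proof. exact: sigma_algebra_bigcup. Qed.

HB.instance Definition _ := @isMeasurable.Build (row_display d)
  'rV[T]_n (g_sigma_preimage coors) row_set0 row_setC row_bigcup.

End measurable_row.

Lemma measurable_coord d (T : measurableType d) n (i : 'I_n) :
  measurable_fun [set: 'rV[T]_n] (fun x : 'rV[T]_n => x ord0 i).
Proof.
move=> _ Y mY; rewrite setTI; apply: sub_sigma_algebra => /=.
rewrite -bigcup_seq/=; exists i => /=; first by rewrite mem_index_enum.
by exists Y => //; rewrite setTI.
Qed.

Lemma measurable_fun_row d1 d2 (T1 : measurableType d1) (T2 : measurableType d2)
    n (f : T1 -> 'rV[T2]_n) :
  (forall i, measurable_fun [set: T1] (fun x => f x ord0 i)) ->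
  measurable_fun [set: T1] f.
Proof.
move=> mf; apply: measurability => //.
move=> A [B + <-]; rewrite -bigcup_seq => -[i _ [C mC <-]].
by rewrite setTI; exact: (mf i measurableT C mC).
Qed.

Definition row_cons T n (p : T * 'rV[T]_n) : 'rV[T]_n.+1 :=
  \row_i (if unlift ord0 i is Some j then p.2 ord0 j else p.1).

Lemma measurable_row_cons d (T : measurableType d) n :
  measurable_fun [set: (T * 'rV[T]_n)%type] (@row_cons T n).
Proof.
apply: measurable_fun_row => i.
case: (unliftP ord0 i) => [j|] ->.
  rewrite (_ : (fun _ => _) = (fun x : 'rV[T]_n => x ord0 j) \o snd).
    exact: (measurableT_comp (measurable_coord j) measurable_snd).
  by apply/funext => p; rewrite mxE liftK.
rewrite (_ : (fun _ => _) = fst); first exact: measurable_fst.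
by apply/funext => p; rewrite mxE unlift_none.
Qed.

Lemma sigma_finite_product_measure1 d1 d2 (T1 : measurableType d1)
    (T2 : measurableType d2) (R : realType)
    (m1 : {sigma_finite_measure set T1 -> \bar R})
    (m2 : {sigma_finite_measure set T2 -> \bar R}) :
  sigma_finite [set: (T1 * T2)%type] (m1 \x m2)%E.
Proof.
have /sigma_finiteP[F [TF ndF Foo]] := sigma_finiteT m1.
have /sigma_finiteP[G [TG ndG Goo]] := sigma_finiteT m2.
exists (fun n => F n `*` G n).
  rewrite -setXTT TF TG predeqE => -[x y]; split; last first.
    by move=> [n _ []/= ? ?]; split; exists n.
  move=> [/= [n _ Fnx] [k _ Gky]]; exists (maxn n k) => //; split.
  - by move: x Fnx; exact/subsetPset/ndF/leq_maxl.
  - by move: y Gky; exact/subsetPset/ndG/leq_maxr.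
move=> k; have [? ?] := Foo k; have [? ?] := Goo k.
split; first exact: measurableX.
by rewrite product_measure1E// lte_mul_pinfty// ge0_fin_numE.
Qed.

Lemma sigma_finite_pushforward_row_cons d (T : measurableType d) (R : realType)
    n (m : set (T * 'rV[T]_n)%type -> \bar R) :
  sigma_finite setT m -> sigma_finite setT (pushforward m (@row_cons T n)).
Proof.
move=> [F TF mF].
pose g (x : 'rV[T]_n.+1) := (x ord0 ord0, \row_j x ord0 (lift ord0 j)).
have gK p : g (row_cons p) = p.
  case: p => a v; rewrite /g /row_cons mxE unlift_none /=; congr pair.
  by apply/rowP => j; rewrite !mxE liftK.
have mg : measurable_fun setT g.
  apply/measurable_fun_pairP; split; first exact: measurable_coord.
  apply: measurable_fun_row => i.
  rewrite (_ : (fun _ => _) = fun x : 'rV[T]_n.+1 => x ord0 (lift ord0 i)).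
    exact: measurable_coord.
  by apply/funext => x; rewrite mxE.
exists (fun i => g @^-1` F i).
  by rewrite -preimage_bigcup -TF preimage_setT.
move=> i; have [mFi Fi] := mF i; split.
  by rewrite -[X in measurable X]setTI; exact: mg.
rewrite /pushforward (_ : _ @^-1` _ = F i)//.
by apply/seteqP; split=> p /=; rewrite gK.
Qed.

Section row_cons_measure.
Context d (T : measurableType d) (R : realType) (n : nat).
Variables (mu : {sigma_finite_measure set T -> \bar R}).
Variables (nu : {sigma_finite_measure set 'rV[T]_n -> \bar R}).

Definition row_cons_measure : set 'rV[T]_n.+1 -> \bar R :=
  pushforward (mu \x nu)%E (@row_cons T n).

Let row_cons_measure0 : row_cons_measure set0 = 0%E.
Proof. by rewrite /row_cons_measure /pushforward preimage_set0 measure0. Qed.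

Let row_cons_measure_ge0 A : (0 <= row_cons_measure A)%E.
Proof. by rewrite /row_cons_measure /pushforward; exact: measure_ge0. Qed.

Let row_cons_measure_sigma_additive : semi_sigma_additive row_cons_measure.
Proof.
exact: (@measure_semi_sigma_additive _ _ _
  (@measure_function_pushforward__canonical__measure_function_Measure
    _ _ _ _ _ (mu \x nu)%E _ (@measurable_row_cons _ T n))).
Qed.

HB.instance Definition _ := isMeasure.Build _ _ _ row_cons_measure
  row_cons_measure0 row_cons_measure_ge0 row_cons_measure_sigma_additive.

HB.instance Definition _ := Measure_isSigmaFinite.Build _ _ _ row_cons_measure
  
  (sigma_finite_pushforward_row_cons (sigma_finite_product_measure1 mu nu)).

End row_cons_measure.

(* The n-fold product measure on T^n.  For a probability mu it is the joint law
   of n independent copies of a random element with law mu. *)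
Fixpoint power_measure d (T : measurableType d) (R : realType)
    (mu : {sigma_finite_measure set T -> \bar R}) (n : nat) :
    {sigma_finite_measure set 'rV[T]_n -> \bar R} :=
  if n is n'.+1 return {sigma_finite_measure set 'rV[T]_n -> \bar R}
  then row_cons_measure mu (power_measure mu n')
  else dirac (const_mx point).

Lemma power_measure_box d (T : measurableType d) (R : realType)
    (mu : {sigma_finite_measure set T -> \bar R}) n (A : 'I_n -> set T) :
  (forall i, measurable (A i)) ->
  power_measure mu n [set x | forall i, A i (x ord0 i)] =
  (\prod_(i < n) mu (A i))%E.
Proof.
elim: n A => [|n IH] A mA.
  by rewrite big_ord0 /= diracE mem_set// => -[].
rewrite big_ord_recl /= -IH//.
rewrite /row_cons_measure /pushforward /= -product_measure1E//; last first.
  rewrite (_ : (fun _ => _) =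
      \big[setI/setT]_(i < n) (fun x : 'rV_n => x ord0 i) @^-1` A (lift ord0 i)).
    apply: bigsetI_measurable => i _; rewrite -[X in measurable X]setTI.
    exact: measurable_coord.
  apply/seteqP; split=> x /=.
    by move=> Ax; rewrite -bigcap_seq => i _; exact: Ax.
  by rewrite -bigcap_seq => Ax i; apply: Ax; rewrite /= mem_index_enum.
congr ((_ \x _)%E _).
apply/seteqP; split=> -[a v] /=.
  move=> Aav; split; first by have := Aav ord0; rewrite mxE unlift_none.
  by move=> i; have := Aav (lift ord0 i); rewrite mxE liftK.
move=> [Aa Av] i; rewrite mxE /=.
by case: (unliftP ord0 i) => [j|] ->; [exact: Av|exact: Aa].
Qed.

(* The library declares lebesgue_measure on measurableTypeR R, which has the same
   measurable sets as R but a different display. *)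
Section lebesgue_real.
Context (R : realType).

Definition lebesgue_real : set R -> \bar R := @lebesgue_measure R.

Let lebesgue_real_sigma_additive : semi_sigma_additive lebesgue_real.
Proof. exact: (@measure_semi_sigma_additive _ _ _ (@lebesgue_measure R)). Qed.

Let lebesgue_real0 : lebesgue_real set0 = 0%E.
Proof. exact: measure0. Qed.

Let lebesgue_real_ge0 A : (0 <= lebesgue_real A)%E.
Proof. exact: measure_ge0. Qed.

HB.instance Definition _ := isMeasure.Build _ _ _ lebesgue_real
  lebesgue_real0 lebesgue_real_ge0 lebesgue_real_sigma_additive.

Let lebesgue_real_sigma_finite : sigma_finite setT lebesgue_real.
Proof. exact: (sigma_finiteT (@lebesgue_measure R)). Qed.

HB.instance Definition _ := Measure_isSigmaFinite.Build _ _ _ lebesgue_real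
  lebesgue_real_sigma_finite.

End lebesgue_real.

Definition lebesgue_row (R : realType) (k : nat) :
    {sigma_finite_measure set 'rV[R]_k -> \bar R} :=
  power_measure (@lebesgue_real R) k.

Section max_stable.
Context {R : realType} {k : nat}.
Implicit Types (P : probability 'rV[R]_k R) (z : 'rV[R]_k).

Definition orthant : set 'rV[R]_k := [set z | forall i, 0 < z ord0 i].

Definition componentwise_max n (x : 'rV['rV[R]_k]_n.+1) : 'rV[R]_k :=
  \row_j \big[Order.max/x ord0 ord0 ord0 j]_(i < n.+1) x ord0 i ord0 j.

(* The number n >= 1 of copies is written n.+1. *)
Definition simple_max_stable P : Prop :=
  (forall (i : 'I_k) (t : R), 0 < t ->
    P [set x | x ord0 i <= t] = (expR (- 1 / t))%:E) /\
  (forall (n : nat) (B : set 'rV[R]_k), measurable B ->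
    pushforward (power_measure P n.+1) (@componentwise_max n) B =
    pushforward P (fun z => n.+1%:R *: z) B).

Definition distribution_function P z : R :=
  fine (P [set x | forall i, x ord0 i <= z ord0 i]).

Definition exponent_function P z : R := - ln (distribution_function P z).

Definition partial (i : 'I_k) (g : 'rV[R]_k -> R) : 'rV[R]_k -> R :=
  fun z => 'D_(delta_mx ord0 i) g z.

(* Indices are enumerated increasingly, so that for tau = {i_1 < ... < i_m} this
   is \partial_{i_1} (... (\partial_{i_m} g)). *)
Definition mixed_partial (tau : {set 'I_k}) (g : 'rV[R]_k -> R) :
    'rV[R]_k -> R :=
  foldr partial g (enum tau).

(* All the mixed_partial tau g exist on the orthant: if i is less than every
   index of tau, then \partial_{i, tau} g = \partial_i \partial_tau g.
   No order of differentiation other than the one above is required. *)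
Definition has_mixed_partials (g : 'rV[R]_k -> R) : Prop :=
  forall (tau : {set 'I_k}) (i : 'I_k), (forall j, j \in tau -> (i < j)%N) ->
  forall z, orthant z -> derivable (mixed_partial tau g) z (delta_mx ord0 i).

Definition max_stable_density (V : 'rV[R]_k -> R) : 'rV[R]_k -> R :=
  (fun z => \sum_(p : {set {set 'I_k}} | finset.partition p [set: 'I_k]%SET)
     expR (- V z) * \prod_(tau in p) (- mixed_partial tau V z)) \_ orthant.

Definition is_density P (f : 'rV[R]_k -> R) : Prop :=
  [/\ forall z, 0 <= f z, measurable_fun [set: 'rV[R]_k] f &
      forall B, measurable B -> 
        P B = (\int[lebesgue_row R k]_(z in B) (f z)%:E)%E].

Definition is_norm (N : 'rV[R]_k -> R) : Prop :=
  [/\ forall x y, N (x + y) <= N x + N y,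
      forall (a : R) x, N (a *: x) = `|a| * N x &
      forall x, N x = 0 -> x = 0].

End max_stable.

Definition gradient (R : realType) (D : nat) (g : 'rV[R]_D -> R)
    (theta : 'rV[R]_D) : 'rV[R]_D :=
  \row_i 'D_(delta_mx ord0 i) g theta.

(* The o(|h|^2) is unfolded in \bar R, so that an infinite integral is not
   mistaken for a small one.  `|h| is the sup norm; all norms on R^D give the
   same notion. *)
Definition dqm_with_score (R : realType) (D k : nat)
    (f : 'rV[R]_D -> 'rV[R]_k -> R) (theta0 : 'rV[R]_D)
    (score : 'rV[R]_k -> 'rV[R]_D) : Prop :=
  measurable_fun [set: 'rV[R]_k] score /\
  forall e : R, 0 < e -> \forall h \near (0 : 'rV[R]_D),
    (\int[lebesgue_row R k]_z
       ((Num.sqrt (f (theta0 + h)%R z) - Num.sqrt (f theta0 z)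
         - 2^-1 * (h *m (score z)^T) ord0 ord0 * Num.sqrt (f theta0 z)) ^+ 2)%:E
     <= (e * `|h| ^+ 2)%:E)%E.

(* Main.v *)
Require Import Defs.
From HB Require Import structures.
From mathcomp Require Import all_boot all_order all_algebra.
From mathcomp Require Import all_classical all_reals all_analysis.
From mathcomp Require Import measurable_realfun.
From mathcomp Require Import ring lra.

Set Implicit Arguments.
Unset Strict Implicit.
Unset Printing Implicit Defensive.
Import Order.TTheory GRing.Theory Num.Theory.
Import numFieldNormedType.Exports.

Local Open Scope classical_set_scope.
Local Open Scope ring_scope.

(** The densities are positive combinations of products of the functions
exp(-V) and -\partial_tau V, so bounds on the theta-derivatives of ln V and of
ln \partial_tau V give a bound |\partial_theta ln f_theta(z)| <= G(z) that is
uniform in theta.  Two features of max-stable laws make this work.  First,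
V_theta(s z) = V_theta(z) / s, hence \partial_tau V_theta is homogeneous too,
and bounds on the unit sphere of the norm extend to the whole orthant
([exponent_function_scale], [mixed_partial_scale]).  Second,
-\partial_tau V_theta >= 0 for tau nonempty: V_theta is the limit of
n (1 - F_theta(n z)) and the rectangular increments of a distribution function
are probabilities ([exponent_function_nonpos_increments],
[mixed_partial_le0]).  Hence no cancellation occurs in the sum over partitions,
and the logarithmic derivative of the sum is a weighted mean of the ones of its
terms.  Instead of ln g, which degenerates where g vanishes, the proof uses the
inequality |D_v g| <= C |v| g ([log_lip]), which is stable under sums and
products; the outcome is [log_lip_max_stable_density].

The function G is unbounded near the boundary of the orthant and at infinity.
It is controlled on the boxes E_n = [2^-n, 2^(m n)]^k, on which it is at most
g_n = M b^n with b = 2^(1 + (m + 1) alpha) ([angular_bound_le]), while the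
standard Frechet margins, common to all theta, give
P_theta(~ E_n) <= q 2^(-m n) ([probability_outside_box_le]).  Since
alpha < 1/2, the integer m can be chosen with b^2 < 2^m
([exists_tail_exponent]), and then \sum_n g_(n+1)^2 P_theta(~ E_n) converges
uniformly in theta.

Differentiability in quadratic mean follows ([qm_remainder_negligible]).  The
mean value theorem for ln f_theta and |sqrt a - sqrt b| <=
max(sqrt a, sqrt b) |ln a - ln b| / 2 bound the squared remainder on E_n by
g_n^2 |h|^2 (f_(theta0 + h) + f_theta0).  Summed over the shells
E_(n+1) \ E_n, this makes its integral over ~ E_m at most |h|^2 times a tail of
the convergent series above, uniformly in h.  On the box E_m the densities are
comparable, f_(theta0 + h) <= const f_theta0, so that the pointwise
differentiability of sqrt f_theta and dominated convergence conclude. *)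

(** * Functions with a bounded logarithmic derivative *)

Section log_lipschitz.
Context {R : realType} {W : normedModType R}.
Implicit Types (g : W -> R) (x v : W) (C : R).

Lemma near_eq_differentiable g g' x :
  (\near x, g x = g' x) -> differentiable g x -> differentiable g' x.
Proof.
move=> gg' /[dup] dg /diff_locallyP[cdg edg].
suff H : g' \o shift x = cst (g' x) + 'd g x +o_ 0 id.
  by apply/diff_locallyP; rewrite (diff_unique cdg H).
apply/eqaddoP => e e0.
have /eqaddoP/(_ e e0) := edg.
have gx : g x = g' x by exact: nbhs_singleton gg'.
have gg0 : \forall y \near (0 : W), g (y + x) = g' (y + x).
  by move: gg'; rewrite (near_shift 0 x) subr0.
by apply: filterS2 gg0 => y /= ey; rewrite !fctE /= -gx ey.
Qed.

(** Where [g x] is positive the bound says that the differential of [ln \o g]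
at [x] has norm at most [C]; written without the logarithm it also makes sense
at the zeros of [g], where it forces the differential to vanish, and it passes
to sums and products. *)
Definition log_lip C g x := [/\ differentiable g x, 0 <= g x &
  forall v, `|'D_v g x| <= C * `|v| * g x].

Lemma log_lip_near C g g' x :
  (\near x, g x = g' x) -> log_lip C g x -> log_lip C g' x.
Proof.
move=> gg' [dg g0 gC]; have gx := nbhs_singleton gg'.
split; first exact: near_eq_differentiable dg.
- by rewrite -gx.
- by move=> v; rewrite -gx -(near_eq_derive v gg').
Qed.

Lemma log_lip_le C C' g x : C <= C' -> log_lip C g x -> log_lip C' g x.
Proof.
move=> CC' [dg g0 gC]; split => // v; apply: le_trans (gC v) _.
by rewrite ler_wpM2r// ler_wpM2r.
Qed.

Lemma log_lip_cst C (c : R) x : 0 <= C -> 0 <= c -> log_lip C (fun=> c) x.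
Proof.
move=> C0 c0; split => // v.
by rewrite derive_cst normr0 !mulr_ge0.
Qed.

(** The logarithmic derivative of a sum is a weighted mean of the logarithmic
derivatives of the terms: nonnegativity keeps the constant from growing. *)
Lemma log_lipD C g g' x : log_lip C g x -> log_lip C g' x ->
  log_lip C (fun y => g y + g' y) x.
Proof.
move=> [dg g0 gC] [dg' g0' gC']; split.
- exact: (differentiableD dg dg').
- exact: addr_ge0.
- move=> v; rewrite (_ : (fun _ => _) = g + g')// deriveD; try exact: diff_derivable.
  by rewrite mulrDr (le_trans (ler_normD _ _))// lerD.
Qed.

Lemma log_lipM C C' g g' x : log_lip C g x -> log_lip C' g' x ->
  log_lip (C + C') (fun y => g y * g' y) x.
Proof.
move=> [dg g0 gC] [dg' g0' gC']; split.
- exact: (differentiableM dg dg').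
- exact: mulr_ge0.
- move=> v; rewrite (_ : (fun _ => _) = g * g')// deriveM; try exact: diff_derivable.
  rewrite (le_trans (ler_normD _ _))// addrC /GRing.scale/= !normrM (ger0_norm g0) (ger0_norm g0').
  have := ler_wpM2l g0' (gC v); have := ler_wpM2l g0 (gC' v); nra.
Qed.

Lemma log_lip_sum (I : Type) (r : seq I) (Q : pred I) (g : I -> W -> R) C x :
  0 <= C -> (forall i, Q i -> log_lip C (g i) x) ->
  log_lip C (fun y => \sum_(i <- r | Q i) g i y) x.
Proof.
move=> C0 gC; elim: r => [|i r IH].
  under eq_fun do rewrite big_nil; exact: log_lip_cst.
under eq_fun do rewrite big_cons; case Qi: (Q i) => //.
by apply: log_lipD => //; exact: gC.
Qed.

Lemma log_lip_prod (I : Type) (r : seq I) (Q : pred I) (g : I -> W -> R) C x :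
  0 <= C -> (forall i, Q i -> log_lip C (g i) x) ->
  log_lip ((size r)%:R * C) (fun y => \prod_(i <- r | Q i) g i y) x.
Proof.
move=> C0 gC; elim: r => [|i r IH].
  under eq_fun do rewrite big_nil; apply: log_lip_cst => //=.
  by rewrite mul0r.
have SC : (size (i :: r))%:R * C = C + (size r)%:R * C.
  by rewrite /= -natr1 mulrDl mul1r addrC.
under eq_fun do rewrite big_cons; case Qi: (Q i); rewrite SC.
  by apply: log_lipM => //; exact: gC.
by apply: log_lip_le IH; rewrite lerDr.
Qed.

Lemma differentiable_lnE g x : differentiable g x -> 0 < g x ->
  differentiable (fun y => ln (g y)) x /\
  forall v, 'D_v (fun y => ln (g y)) x = 'D_v g x / g x.
Proof.
move=> dg g0.
have [dl el] := is_derive1_ln g0.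
have dl' : differentiable (@ln R) (g x) by exact/derivable1_diffP.
have dc : differentiable (fun y => ln (g y)) x by exact: (differentiable_comp dg dl').
split => // v; rewrite deriveE// (_ : (fun _ => _) = @ln R \o g)// diff_comp//=.
rewrite deriveE// diff1E// derive1E el /GRing.scale/=; lra.
Qed.

Lemma differentiable_expRNE g x : differentiable g x ->
  differentiable (fun y => expR (- g y)) x /\
  forall v, 'D_v (fun y => expR (- g y)) x = - ('D_v g x * expR (- g x)).
Proof.
move=> dg; have dNg : differentiable (fun y => - g y) x by exact: differentiableN.
have [dl el] := is_derive_expR (- g x).
have dl' : differentiable (@expR R) (- g x) by exact/derivable1_diffP.
have dc : differentiable (fun y => expR (- g y)) x by exact: (differentiable_comp dNg dl').
split => // v; rewrite deriveE// (_ : (fun _ => _) = @expR R \o (fun y => - g y))//.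
rewrite diff_comp//=.
rewrite diff1E// derive1E el /GRing.scale/= -deriveE//.
rewrite (_ : (fun _ => _) = - g)// deriveN; last exact: diff_derivable.
by rewrite mulNr.
Qed.

Lemma is_derive_line g x h (s : R) : differentiable g (x + s *: h) ->
  is_derive s 1 (fun t : R => g (x + t *: h)) ('D_h g (x + s *: h)).
Proof.
move=> dg.
have dl : is_diff s (fun t : R => x + t *: h) ( *:%R^~ h).
  rewrite -[X in is_diff _ _ X]add0r.
  exact: (is_diffD (is_diff_cst x s) (is_diff_scalel s h)).
have dc : differentiable (g \o (fun t : R => x + t *: h)) s.
  exact: differentiable_comp.
split; first exact/derivable1_diffP.
rewrite deriveE//= diff_comp//= diff_val scale1r -deriveE//.
Qed.

(** Mean value theorem for [ln \o g] on the segment from [x] to [x + h]. *)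
Lemma log_lip_increment C g x h : 0 <= C ->
  (forall s : R, 0 <= s <= 1 -> log_lip C g (x + s *: h)) ->
  (forall s : R, 0 <= s <= 1 -> 0 < g (x + s *: h)) ->
  `|ln (g (x + h)) - ln (g x)| <= C * `|h|.
Proof.
move=> C0 gC gp.
pose phi (s : R) := ln (g (x + s *: h)).
have dphi (s : R) : 0 <= s <= 1 ->
    is_derive s 1 phi ('D_h g (x + s *: h) / g (x + s *: h)).
  move=> s01; have [dg _ _] := gC s s01.
  have [dl el] := differentiable_lnE dg (gp s s01).
  by rewrite -el; exact: (is_derive_line dl).
have [||s s01] := @MVT R phi (fun s => 'D_h g (x + s *: h) / g (x + s *: h)) 0 1 ltr01.
- by move=> s /[!in_itv]/= /andP[s0 s1]; apply: dphi; rewrite !ltW.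
- apply: derivable_within_continuous => s /[!in_itv]/= s01.
  by have [] := dphi s s01.
rewrite /phi scale1r scale0r addr0 subr0 mulr1 => ->.
have s01' : 0 <= s <= 1.
  by move: s01; rewrite in_itv/= => /andP[s0 s1]; rewrite !ltW.
have [_ _ gCs] := gC s s01'; have g0 := gp s s01'.
by rewrite normrM normfV (gtr0_norm g0) ler_pdivrMr.
Qed.

End log_lipschitz.

(** * The pointwise remainder of the expansion of the square root *)

Section quadratic_mean.
Context {R : realType} {W : normedModType R} d (T : measurableType d).

(** For [u <= v] the inequality [ln t <= t - 1] at [t = u / v] gives
[v - u <= v (ln v - ln u)]; it is applied to the square roots of [a] and [b],
whose logarithms are half those of [a] and [b]. *)
Lemma sqrt_increment (a b L : R) : 0 < a -> 0 < b -> `|ln b - ln a| <= L ->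
  (Num.sqrt b - Num.sqrt a) ^+ 2 <= (L / 2) ^+ 2 * (a + b).
Proof.
wlog ab : a b / a <= b => [hw a0 b0 abL|].
  have [/hw|/ltW/hw h] := leP a b; first by move=> /(_ a0 b0 abL).
  by rewrite -sqrrN opprB (addrC a); apply: h => //; rewrite distrC.
move=> a0 b0 abL.
pose u := Num.sqrt a; pose v := Num.sqrt b.
have u0 : 0 < u by rewrite sqrtr_gt0.
have v0 : 0 < v by rewrite sqrtr_gt0.
have ua : a = u ^+ 2 by rewrite sqr_sqrtr// ltW.
have vb : b = v ^+ 2 by rewrite sqr_sqrtr// ltW.
have uv : u <= v by apply: ler_wsqrtr.
have uvL : ln v - ln u <= L / 2.
  move: abL; rewrite ua vb !lnXn// -mulrnBl normrMn => abL.
  rewrite ler_pdivlMr// (le_trans _ abL)// mulr_natr lerMn2r/=; exact: ler_norm.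
have luv : ln u - ln v <= u / v - 1.
  rewrite -ln_div// -[in leLHS](subrK 1 (u / v)) addrC; apply: le_ln1Dx.
  by rewrite ltrBrDr addNr divr_gt0.
have {}luv : v - u <= v * (L / 2).
  rewrite -ler_pdivrMl// mulrC mulrBl divff ?gt_eqF//; lra.
rewrite -/u -/v ua vb.
have : (v - u) ^+ 2 <= (v * (L / 2)) ^+ 2.
  by rewrite ler_sqr// nnegrE; lra.
move=> /le_trans; apply.
rewrite exprMn mulrC ler_wpM2l ?sqr_ge0// lerDr sqr_ge0//.
Qed.

(** The derivative of [ln (f ^~ z)] in the direction [h].  Division by [0]
gives [0], so that it vanishes where [f x0] does. *)
Definition score_at (f : W -> T -> R) x0 (h : W) (z : T) : R :=
  'D_h (f ^~ z) x0 / f x0 z.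

Definition qm_remainder (f : W -> T -> R) x0 (h : W) (z : T) : R :=
  Num.sqrt (f (x0 + h) z) - Num.sqrt (f x0 z)
  - 2^-1 * score_at f x0 h z * Num.sqrt (f x0 z).

Lemma segment_in_ball (h : W) (r s : R) : `|h| < r -> 0 <= s <= 1 -> `|s *: h| < r.
Proof.
move=> hr /andP[s0 s1]; apply: le_lt_trans hr.
by rewrite normrZ ger0_norm// ler_piMl.
Qed.

Variables (f : W -> T -> R) (x0 : W) (r : R).
Hypothesis r0 : 0 < r.

Section pointwise.
Variables (z : T) (g : R).
Hypothesis g0 : 0 <= g.
Hypothesis f_lip : forall h, `|h| < r -> log_lip g (f ^~ z) (x0 + h).
Hypothesis fpos : forall h h', `|h| < r -> `|h'| < r ->
  0 < f (x0 + h) z -> 0 < f (x0 + h') z.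

Let f_lip0 : log_lip g (f ^~ z) x0.
Proof. by rewrite -[x0]addr0; apply: f_lip; rewrite normr0. Qed.

Let pos_or_null : (forall h, `|h| < r -> 0 < f (x0 + h) z) \/
  (forall h, `|h| < r -> f (x0 + h) z = 0).
Proof.
have [p|np] := pselect (0 < f x0 z).
  by left => h hr; apply: (fpos _ hr (h := 0)); rewrite ?normr0// addr0.
right=> h hr; have [_ + _] := f_lip hr; rewrite le_eqVlt => /orP[/eqP//|p].
by exfalso; apply: np; rewrite -[x0]addr0; apply: (fpos hr _ p); rewrite normr0.
Qed.

Let log_increment h : `|h| < r -> (forall h, `|h| < r -> 0 < f (x0 + h) z) ->
  `|ln (f (x0 + h) z) - ln (f x0 z)| <= g * `|h|.
Proof.
move=> hr p; apply: (@log_lip_increment _ _ g (f ^~ z)) => // s s01.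
  by apply: f_lip; exact: segment_in_ball.
by apply: p; exact: segment_in_ball.
Qed.

(** The remainder is the increment of the square root minus its linear part;
both are bounded through the logarithmic derivative. *)
Lemma qm_remainder_le h : `|h| < r ->
  qm_remainder f x0 h z ^+ 2 <= g ^+ 2 * `|h| ^+ 2 * (f (x0 + h) z + f x0 z).
Proof.
move=> hr; rewrite /qm_remainder.
have r00 : `|0 : W| < r by rewrite normr0.
case: pos_or_null => p; last first.
  have fx0 : f x0 z = 0 by rewrite -[x0]addr0 p.
  by rewrite p// fx0 sqrtr0 mulr0 !subrr expr0n/= addr0 mulr0.
have := sqrt_increment _ _ (log_increment hr p).
have f0 : 0 < f x0 z by rewrite -[x0]addr0 p.
have fh := p _ hr.
move=> /(_ f0 fh) => H1.
have H2 : (2^-1 * score_at f x0 h z * Num.sqrt (f x0 z)) ^+ 2 <=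
    (g * `|h| / 2) ^+ 2 * f x0 z.
  rewrite exprMn (sqr_sqrtr (ltW f0)) (ler_wpM2r (ltW f0))//.
  have G0 : 0 <= g * `|h| / 2 by rewrite divr_ge0// mulr_ge0.
  rewrite -[leLHS]ger0_norm ?sqr_ge0// normrX lerXn2r ?nnegrE//.
  rewrite normrM (@gtr0_norm _ 2^-1)// mulrC ler_wpM2r//; have [_ _ fl] := f_lip0.
  by rewrite /score_at normrM normfV (gtr0_norm f0) ler_pdivrMr.
move: H1 H2; set A := Num.sqrt _ - _; set B := _ * _ * Num.sqrt _; set G := g * `|h|.
rewrite -exprMn -/G => H1 H2.
have := sqr_ge0 (A + B); have := sqr_ge0 G; nra.
Qed.

(** An additive bound on [ln f] is a multiplicative one on [f]; it turns
[f x0] into a dominating function for its neighbours. *)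
Lemma density_le h : `|h| < r -> f (x0 + h) z <= expR (g * r) * f x0 z.
Proof.
move=> hr; case: pos_or_null => p; last first.
  by have := p 0; rewrite addr0 normr0 => /(_ r0) ->; rewrite p// mulr0.
have f0 : 0 < f x0 z by rewrite -[x0]addr0 p// normr0.
have fh := p _ hr.
rewrite -ler_pdivrMr// -ler_ln ?posrE ?divr_gt0 ?expR_gt0// expRK ln_div//.
apply: le_trans (ler_norm _) _; apply: le_trans (log_increment hr p) _.
by rewrite ler_wpM2l// ltW.
Qed.

Lemma qm_remainder_littleo (e : R) : 0 < e ->
  \forall h \near (0 : W), `|qm_remainder f x0 h z| <= e * `|h|.
Proof.
move=> e0; case: pos_or_null => p; last first.
  near=> h; rewrite /qm_remainder.
  have -> : f (x0 + h) z = 0 by apply: p; near: h; exact: nbhs0_lt.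
  rewrite (_ : f x0 z = 0); last by rewrite -[x0]addr0 p// normr0.
  by rewrite sqrtr0 mulr0 !subrr normr0 mulr_ge0// ltW.
have f0 : 0 < f x0 z by rewrite -[x0]addr0 p// normr0.
have [df _ _] := f_lip0.
have [dl el] := is_derive1_sqrt f0.
have dl' : differentiable (@Num.sqrt R) (f x0 z) by exact/derivable1_diffP.
have dc : differentiable (@Num.sqrt R \o (f ^~ z)) x0 by exact: (differentiable_comp df dl').
have /diff_locallyP[_ /eqaddoP/(_ e e0)] := dc.
apply: filterS => h /=; rewrite /qm_remainder !fctE/= opprD addrA.
rewrite diff_comp//= diff1E// derive1E el /GRing.scale/= -deriveE// /score_at.
rewrite (addrC h); congr (`|_ - _| <= _).
rewrite -{2}(sqr_sqrtr (ltW f0)).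
have : Num.sqrt (f x0 z) != 0 by rewrite gt_eqF// sqrtr_gt0.
move=> s0; field.
by rewrite s0.
Unshelve. all: by end_near. Qed.

End pointwise.
End quadratic_mean.

(** * A criterion for differentiability in quadratic mean *)

Section quadratic_mean_criterion.
Context {R : realType} {W : normedModType R} d (T : measurableType d)
  (mu : {measure set T -> \bar R}).
Variables (f : W -> T -> R) (x0 : W) (r : R).
Hypothesis r0 : 0 < r.
Hypothesis fm : forall h, `|h| < r -> measurable_fun [set: T] (f (x0 + h)).

Let fm0 : measurable_fun [set: T] (f x0).
Proof. by rewrite -[x0]addr0; apply: fm; rewrite normr0. Qed.

(** A directional derivative in the parameter is a limit of a sequence of
difference quotients, each of which is measurable in [z]. *)
Lemma measurable_derive_param h : (forall z, differentiable (f ^~ z) x0) ->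
  measurable_fun [set: T] (fun z => 'D_h (f ^~ z) x0).
Proof.
move=> df.
have /cvgr0_norm_lt/(_ r r0)[M _ hM] :
    (fun n => (n.+1%:R^-1 : R) *: h) @ \oo --> (0 : W).
  by rewrite -(scale0r h); apply: cvgZr_tmp; exact: cvg_harmonic.
(* The shift by [M] keeps every point of the sequence in the ball of radius [r]. *)
pose u n : R := (n + M).+1%:R^-1.
apply: (measurable_fun_cvg (h := fun n z => (u n)^-1 * (f (x0 + u n *: h) z - f x0 z))).
  move=> n; apply: measurable_funM; first exact: measurable_cst.
  apply: measurable_funB => //; apply: fm; apply: hM => /=; exact: leq_addl.
move=> z _.
have u0 : u n @[n --> \oo] --> (0 : R).
  by rewrite (cvg_shiftn M (fun n => n.+1%:R^-1 : R)); exact: cvg_harmonic.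
have dh : derivable (f ^~ z) x0 h by exact: diff_derivable.
have dh' : (fun t : R => t^-1 *: (((f ^~ z) \o shift x0) (t *: h) - f x0 z)) @ 0^'
    --> ('D_h (f ^~ z) x0 : R) by exact: dh.
have /cvgr_dnbhsP/(_ u) H := dh'.
have {}H : (fun n => (u n)^-1 *: (((f ^~ z) \o shift x0) (u n *: h) - f x0 z)) @ \oo
    --> ('D_h (f ^~ z) x0 : R).
  by apply: H; split => // n; rewrite invr_neq0.
apply: cvg_trans H; apply: near_eq_cvg; near=> n.
by rewrite /= (addrC _ x0).
Unshelve. all: by end_near. Qed.

(** The sets [E n] exhaust the common support; [g n] bounds the logarithmic
derivative on [E n], [p n] bounds the mass left outside of [E n], and [gpsum]
is the trade-off between the two. *)
Variables (E : nat -> set T) (g p : nat -> R).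
Hypothesis mE : forall n, measurable (E n).
Hypothesis ndE : forall m n, (m <= n)%N -> E m `<=` E n.
Hypothesis foff : forall h z, `|h| < r -> ~ (\bigcup_n E n) z -> f (x0 + h) z = 0.
Hypothesis g0 : forall n, 0 <= g n.
Hypothesis f_lip : forall n h z, E n z -> `|h| < r -> log_lip (g n) (f ^~ z) (x0 + h).
Hypothesis fpos : forall h h' z, `|h| < r -> `|h'| < r ->
  0 < f (x0 + h) z -> 0 < f (x0 + h') z.
Hypothesis f_ge0 : forall h z, `|h| < r -> 0 <= f (x0 + h) z.
Hypothesis fint : (\int[mu]_z (f x0 z)%:E < +oo)%E.
Hypothesis ftail : forall n h, `|h| < r ->
  (\int[mu]_(z in ~` E n) (f (x0 + h) z)%:E <= (p n)%:E)%E.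
Hypothesis gpsum : (\sum_(0 <= n <oo) (g n.+1 ^+ 2 * p n)%:E < +oo)%E.

Let differentiable_f z : differentiable (f ^~ z) x0.
Proof.
have [[n _ Enz]|nE] := pselect ((\bigcup_n E n) z).
  have [] // := f_lip Enz (h := 0); rewrite ?normr0//.
  by rewrite addr0.
apply: (@near_eq_differentiable _ _ (cst 0)); last exact: differentiable_cst.
have : \forall h \near (0 : W), `|h| < r by exact: nbhs0_lt.
rewrite (near_shift x0 0); apply: filterS => x /=; rewrite sub0r => xr.
by rewrite -(foff xr nE) addrC subrK.
Qed.

Lemma measurable_score_at h : measurable_fun [set: T] (score_at f x0 h).
Proof.
apply: measurable_funM; first exact: measurable_derive_param.
rewrite (_ : (fun _ => _) = fun z => f x0 z `^ (-1)).
  exact: measurableT_comp (measurable_powR (-1)) fm0.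
by apply/funext => z; rewrite powR_inv1// -[x0]addr0 f_ge0// normr0.
Qed.

Let mrem h : `|h| < r -> measurable_fun [set: T] (qm_remainder f x0 h).
Proof.
have msqrt (k : T -> R) : measurable_fun setT k -> measurable_fun setT (fun z => Num.sqrt (k z)).
  move=> mk; apply: (measurableT_comp _ mk); apply: continuous_measurable_fun.
  exact: sqrt_continuous.
move=> hr; apply: measurable_funB.
  by apply: measurable_funB; apply: msqrt => //; exact: fm.
apply: measurable_funM; last exact: msqrt.
apply: measurable_funM; first exact: measurable_cst.
exact: measurable_score_at.
Qed.

Let rem2_le n h z : E n z -> `|h| < r ->
  qm_remainder f x0 h z ^+ 2 <= g n ^+ 2 * `|h| ^+ 2 * (f (x0 + h) z + f x0 z).
Proof.
move=> Enz hr; apply: (qm_remainder_le r0 (g0 n)) => //.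
by move=> h' h'r; exact: f_lip Enz h'r.
by move=> h1 h2; exact: fpos.
Qed.

Let rem2_off h z : `|h| < r -> ~ (\bigcup_n E n) z -> qm_remainder f x0 h z = 0.
Proof.
move=> hr nE; have f0 : f x0 z = 0 by rewrite -[x0]addr0 foff// normr0.
by rewrite /qm_remainder f0 foff// sqrtr0 mulr0 !subrr.
Qed.

Let mrem2 h (D : set T) : `|h| < r ->
  measurable_fun D (fun z => (qm_remainder f x0 h z ^+ 2)%:E).
Proof.
move=> hr; apply: measurable_funTS; apply/measurable_EFinP.
by apply: measurable_funX; exact: mrem.
Qed.

Let q n : \bar R := (g n.+1 ^+ 2 * p n)%:E.

Let p_ge0 n : 0 <= p n.
Proof.
rewrite -lee_fin; have := @ftail n 0; rewrite normr0 => /(_ r0); apply: le_trans.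
by apply: integral_ge0 => z _; rewrite lee_fin f_ge0// normr0.
Qed.

(** A point outside of [E m] and of first index [N] lies in
[E N] but not in [E N.-1]; the bound on [E N] is charged to the mass outside of
[E N.-1], whence the shift of indices in [gpsum]. *)
Let tail_le m h : `|h| < r ->
  (\int[mu]_(z in ~` E m) (qm_remainder f x0 h z ^+ 2)%:E <=
   (2 * `|h| ^+ 2)%:E * \sum_(m <= n <oo) q n)%E.
Proof.
move=> hr; have r00 : `|0 : W| < r by rewrite normr0.
have f00 z : 0 <= f x0 z by rewrite -[x0]addr0 f_ge0.
have fh0 z : 0 <= f (x0 + h) z by rewrite f_ge0.
have mC n : measurable (~` E n) by exact: measurableC.
pose c n : R := g n.+1 ^+ 2 * `|h| ^+ 2.
have c0 n : 0 <= c n by rewrite mulr_ge0// sqr_ge0.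
pose G n z : \bar R := ((c n)%:E * (f (x0 + h) z + f x0 z)%:E)%E.
have G0 n z : (0 <= G n z)%E by rewrite mule_ge0// lee_fin// addr_ge0.
have mf : measurable_fun setT (fun z => (f (x0 + h) z + f x0 z)%:E).
  by apply/measurable_EFinP/measurable_funD => //; exact: fm.
have mG n (D : set T) : measurable_fun D (G n).
  by apply: measurable_funTS; apply: emeasurable_funM => //; exact: measurable_cst.
pose F n := G (n + m)%N \_ (~` E (n + m)%N).
have F0 n z : (0 <= F n z)%E by rewrite /F patchE; case: ifP.
have mF n : measurable_fun (~` E m) (F n).
  apply: measurable_funTS; apply/(measurable_restrictT _ (mC _)); exact: mG.
rewrite -nneseriesZl; last by move=> n _; rewrite lee_fin mulr_ge0// sqr_ge0.
rewrite -nneseries_addn; last first.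
  by move=> n; rewrite -EFinM lee_fin mulr_ge0 ?mulr_ge0 ?sqr_ge0.
apply: (@le_trans _ _ (\int[mu]_(z in ~` E m) \sum_(0 <= n <oo) F n z)%E).
  apply: ge0_le_integral => //.
  - by move=> z _; rewrite lee_fin sqr_ge0.
  - exact: mrem2.
  - by apply: (@ge0_emeasurable_sum _ _ _ _ F xpredT).
  - move=> z nEm; have [Ez|nE] := pselect ((\bigcup_n E n) z); last first.
      by rewrite rem2_off// expr0n/= nneseries_ge0.
    have exN : exists N, `[< E N z >] by case: Ez => N _ ENz; exists N; exact/asboolP.
    have [N /asboolP ENz Nmin] := ex_minnP exN.
    have mN : (m < N)%N.
      by rewrite ltnNge; apply/negP => Nm; apply: nEm; exact: ndE ENz.
    pose j := (N.-1 - m)%N.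
    have jm : (j + m)%N = N.-1 by rewrite subnK// -ltnS (ltn_predK mN).
    have nEj : ~ E (j + m)%N z.
      rewrite jm => /asboolP/Nmin; rewrite leqNgt => /negP; apply.
      by rewrite (ltn_predK mN).
    rewrite (nneseriesD1 (n := j))//; apply: (@le_trans _ _ (F j z)); last first.
      by rewrite leeDl// nneseries_ge0.
    rewrite /F patchE mem_set// /G -EFinM lee_fin /c jm (ltn_predK mN).
    exact: rem2_le.
rewrite integral_nneseries//; apply: lee_nneseries.
  by move=> n _ _; exact: integral_ge0.
move=> n _; rewrite /F -integral_mkcondr.
apply: (@le_trans _ _ (\int[mu]_(z in ~` E (n + m)%N) G (n + m)%N z)%E).
  by apply: ge0_subset_integral => //; exact: measurableI.
rewrite /G (ge0_integralZl mu (mC _) (measurable_funTS mf))//; last 2 first.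
  - by move=> z _; rewrite lee_fin addr_ge0.
  - by rewrite lee_fin.
rewrite (_ : (2 * _)%:E * _ = (c (n + m)%N)%:E * (p (n + m)%N + p (n + m)%N)%:E)%E; last first.
  by rewrite -!EFinM; congr EFin; rewrite /c; ring.
apply: lee_wpmul2l; first by rewrite lee_fin.
under eq_integral do rewrite EFinD.
rewrite ge0_integralD//.
- rewrite EFinD leeD//; first exact: ftail.
  by have := @ftail (n + m)%N 0 r00; rewrite addr0.
- by move=> z _; rewrite lee_fin.
- by apply: measurable_funTS; apply/measurable_EFinP; exact: fm.
- by move=> z _; rewrite lee_fin.
- by apply: measurable_funTS; apply/measurable_EFinP; exact: fm0.
Qed.

(** On [E m] the quotients [qm_remainder ^+ 2 / |h| ^+ 2] tend to [0] pointwise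
and are dominated by a multiple of [f x0].  Dominated convergence is about
sequences, hence the argument by contradiction along a sequence [h n]. *)
Let core_negligible m (e : R) : 0 < e -> \forall h \near (0 : W),
  (\int[mu]_(z in E m) (qm_remainder f x0 h z ^+ 2)%:E <= (e * `|h| ^+ 2)%:E)%E.
Proof.
move=> e0; apply: contrapT => nP.
have /choice[h hP] n : exists h : W, [/\ `|h| < r, `|h| < n.+1%:R^-1 &
    ~ (\int[mu]_(z in E m) (qm_remainder f x0 h z ^+ 2)%:E <= (e * `|h| ^+ 2)%:E)%E].
  apply: contrapT => nh; apply: nP.
  have n0 : 0 < n.+1%:R^-1 :> R by rewrite invr_gt0.
  apply: filterS2 (nbhs0_lt r0) (nbhs0_lt n0) => h hr hn.
  by apply: contrapT => nle; apply: nh; exists h.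
have hr n : `|h n| < r by have [] := hP n.
have hinv n : `|h n| < n.+1%:R^-1 by have [] := hP n.
have f00 z : 0 <= f x0 z by rewrite -[x0]addr0 f_ge0// normr0.
have h0 n : 0 < `|h n|.
  rewrite normr_gt0; apply/eqP => hn; have [_ _] := hP n; apply.
  rewrite hn normr0 expr0n/= mulr0 integral0_eq//= => z _.
  by rewrite /qm_remainder addr0 subrr /score_at derive0 mul0r mulr0 mul0r subrr expr0n.
have hcvg : h @ \oo --> (0 : W).
  apply/cvgr0Pnorm_lt => _/posnumP[eps]; near=> n.
  apply: lt_trans (hinv n) _; near: n; exact: near_infty_natSinv_lt.
pose F n z := (qm_remainder f x0 (h n) z ^+ 2 / `|h n| ^+ 2)%:E.
pose K := g m ^+ 2 * (expR (g m * r) + 1).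
have K0 : 0 <= K by rewrite mulr_ge0 ?sqr_ge0// addr_ge0// expR_ge0.
have mF n : measurable_fun (E m) (F n).
  apply/measurable_EFinP/measurable_funM; last exact: measurable_cst.
  by apply: measurable_funTS; apply: measurable_funX; exact: mrem.
have F0 n z : (0 <= F n z)%E by rewrite lee_fin divr_ge0// sqr_ge0.
have mf0 (D : set T) : measurable_fun D (fun z => (f x0 z)%:E).
  by apply: measurable_funTS; exact/measurable_EFinP.
have intK : mu.-integrable (E m) (fun z => (K%:E * (f x0 z)%:E)%E).
  apply/integrableP; split.
    by apply: emeasurable_funM; [exact: measurable_cst|exact: mf0].
  rewrite (eq_integral (fun z => K%:E * (f x0 z)%:E)%E); last first.
    by move=> z _; rewrite gee0_abs// mule_ge0// lee_fin.
  rewrite (ge0_integralZl mu (mE m) (mf0 _))//; last by move=> z _; rewrite lee_fin.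
  apply: lte_mul_pinfty => //.
  apply: le_lt_trans fint; apply: ge0_subset_integral => //.
  by move=> z _; rewrite lee_fin.
have Fle n z : E m z -> (`|F n z| <= K%:E * (f x0 z)%:E)%E.
  move=> Ez; rewrite gee0_abs// -EFinM lee_fin ler_pdivrMr ?exprn_gt0//.
  apply: le_trans (rem2_le Ez (hr n)) _.
  rewrite [leRHS](_ : _ = g m ^+ 2 * `|h n| ^+ 2 * (expR (g m * r) * f x0 z + f x0 z));
    last by rewrite /K; ring.
  rewrite ler_wpM2l ?mulr_ge0 ?sqr_ge0// lerD2r.
  apply: (density_le r0 (g0 m)) => //.
  - by move=> h' h'r; exact: f_lip Ez h'r.
  - by move=> h1 h2; exact: fpos.
have Fcvg z : E m z -> F ^~ z @ \oo --> (0 : \bar R)%E.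
  move=> Ez; apply: cvg_EFin; first by near=> n.
  apply/cvgr0Pnorm_lt => eps eps0.
  pose e' := Num.sqrt (eps / 2).
  have e'0 : 0 < e' by rewrite sqrtr_gt0 divr_gt0.
  have lo : \forall h \near (0 : W), `|qm_remainder f x0 h z| <= e' * `|h|.
    by apply: (qm_remainder_littleo r0 (fun h' => f_lip (h := h') Ez)
      (fun h1 h2 => @fpos h1 h2 z)).
  near=> n.
  have le1 : `|qm_remainder f x0 (h n) z| <= e' * `|h n|.
    by near: n; exact: (hcvg _ lo).
  rewrite /= ger0_norm; last by rewrite divr_ge0// sqr_ge0.
  rewrite ltr_pdivrMr ?exprn_gt0//.
  rewrite -[X in X < _]ger0_norm ?sqr_ge0// normrX.
  apply: (@le_lt_trans _ _ ((e' * `|h n|) ^+ 2)).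
    by rewrite lerXn2r ?nnegrE// mulr_ge0// ltW.
  rewrite exprMn sqr_sqrtr ?ltr_pM2r ?exprn_gt0//; last by rewrite divr_ge0// ltW.
  by rewrite ltr_pdivrMr// mulr_natr mulr2n ltrDl.
have m00 : measurable_fun (E m) (fun=> 0%E : \bar R) by exact: measurable_cst.
have [_ _ /=] := dominated_convergence (mE m) mF m00
  (aeW _ Fcvg) intK (aeW _ (fun z n Ez => Fle n z Ez)).
rewrite integral0 => /fine_cvgP[fin] /cvgr0_norm_lt/(_ e e0) near_lt.
have [n [finn ltn]] : exists n, (\int[mu]_(z in E m) F n z \is a fin_num)%E /\
    `|fine (\int[mu]_(z in E m) F n z)%E| < e.
  near \oo%classic => n; exists n; split.
  - by near: n.
  - by near: n.
have [_ _] := hP n; apply.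
rewrite (eq_integral (fun z => ((`|h n| ^+ 2)%:E * F n z)%E)); last first.
  move=> z _; rewrite /F -EFinM; congr EFin.
  by rewrite mulrC divfK// gt_eqF// exprn_gt0.
rewrite (ge0_integralZl mu (mE m) (mF n))//.
rewrite (mulrC e) [in leRHS]EFinM.
apply: lee_wpmul2l; first by rewrite lee_fin sqr_ge0.
rewrite -(fineK finn) lee_fin; apply: le_trans (ltW ltn); exact: ler_norm.
Unshelve. all: by end_near. Qed.

Lemma qm_remainder_negligible (e : R) : 0 < e -> \forall h \near (0 : W),
  (\int[mu]_z (qm_remainder f x0 h z ^+ 2)%:E <= (e * `|h| ^+ 2)%:E)%E.
Proof.
move=> e0.
have q0 n : (0 <= q n)%E by rewrite lee_fin mulr_ge0 ?sqr_ge0.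
have := nneseries_tail_cvg gpsum (fun n _ => q0 n).
move=> /fine_cvgP[fin] /cvgr0_norm_lt/(_ (e / 4)) => /(_ (divr_gt0 e0 _)) near_lt.
have [m [finm ltm]] : exists m, (\sum_(m <= n <oo) q n \is a fin_num)%E /\
    `|fine (\sum_(m <= n <oo) q n)%E| < e / 4.
  near \oo%classic => n; exists n; split.
  - by near: n.
  - by near: n; exact: near_lt.
near=> h.
have hr : `|h| < r by near: h; exact: nbhs0_lt.
rewrite -(setUv (E m)) ge0_integral_setU//; last 4 first.
- exact: measurableC.
- exact: mrem2.
- by move=> z _; rewrite lee_fin sqr_ge0.
- exact/disj_setPCl.
(* Half of [e] pays for the core [E m], the other half for its complement. *)
rewrite [in leRHS](_ : e * _ = e / 2 * `|h| ^+ 2 + (2 * `|h| ^+ 2) * (e / 4)); last by field.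
rewrite EFinD; apply: leeD.
  by near: h; apply: core_negligible; rewrite divr_gt0.
apply: le_trans (tail_le m hr) _; rewrite [in leRHS](EFinM (2 * _)).
apply: lee_wpmul2l.
  by rewrite lee_fin mulr_ge0// sqr_ge0.
rewrite -(fineK finm) lee_fin; apply: le_trans (ltW ltm); exact: ler_norm.
Unshelve. all: by end_near. Qed.

End quadratic_mean_criterion.

(** * Rectangular increments and mixed partial derivatives *)

Section increments.
Context {R : realType} {k : nat}.
Implicit Types (l m : seq 'I_k) (s z : 'rV[R]_k) (g : 'rV[R]_k -> R) (i : 'I_k).

Notation "''e_' i" := (delta_mx ord0 i : 'rV[R]_k) (at level 8, i at level 2, format "''e_' i").

(** The iterated difference of [g] over the box with corner [z] and side
lengths [s], in the coordinates listed in [l]. *)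
Fixpoint increment l s g z : R :=
  if l is i :: l' then
    increment l' s g (z + s ord0 i *: 'e_i) - increment l' s g z
  else g z.

Lemma increment_rcons l i s g z : increment (rcons l i) s g z =
  increment l s (fun y => g (y + s ord0 i *: 'e_i) - g y) z.
Proof. by elim: l z => [//|j l IH] z /=; rewrite !IH. Qed.

Lemma increment_affine l s g (a b : R) z :
  increment l s (fun y => a * g y + b) z =
  a * increment l s g z + (if l is [::] then b else 0).
Proof.
elim: l z => [//|i l IH] z /=; rewrite !IH; case: l {IH} => [|? ?]; ring.
Qed.

Lemma increment_scale l s g (c : R) z :
  increment l s (fun y => g (c *: y)) z = increment l (c *: s) g (c *: z).
Proof.
elim: l z => [//|i l IH] z /=.
by rewrite !IH scalerDr scalerA mxE.
Qed.

Lemma orthantDl z i (t : R) : 0 <= t -> orthant z -> orthant (z + t *: 'e_i).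
Proof.
move=> t0 z0 j; rewrite !mxE ltr_wpDr// mulr_ge0// ler0n.
Qed.

Lemma orthantZ (t : R) z : 0 < t -> orthant z -> orthant (t *: z).
Proof. by move=> t0 z0 i; rewrite mxE mulr_gt0. Qed.

Lemma increment_cvg l s (g_ : nat -> 'rV[R]_k -> R) g z :
  (forall y, orthant y -> g_ n y @[n --> \oo] --> g y) ->
  orthant s -> orthant z ->
  increment l s (g_ n) z @[n --> \oo] --> increment l s g z.
Proof.
move=> gg s0; elim: l z => [|i l IH] z z0 /=; first exact: gg.
by apply: cvgB; apply: IH => //; apply: orthantDl => //; exact: ltW.
Qed.

Lemma increment_eq l s s' g z : {in l, forall i, s ord0 i = s' ord0 i} ->
  increment l s g z = increment l s' g z.
Proof.
elim: l z => [//|i l IH] z ss' /=; rewrite (ss' i) ?mem_head//.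
by rewrite !IH// => j jl; apply: ss'; rewrite in_cons jl orbT.
Qed.

Definition nonpos_increments l g :=
  forall s z, orthant s -> orthant z -> increment l s g z <= 0.

Lemma near_orthant z i : orthant z ->
  \forall t \near (0 : R), orthant (z + t *: 'e_i).
Proof.
move=> z0; have lt_zi : \forall t \near (0 : R), `|t| < z ord0 i by exact: nbhs0_lt.
near=> t => j; rewrite !mxE eqxx/=.
have [->|ji] := eqVneq j i; last by rewrite mulr0 addr0.
rewrite mulr1 -ltrBlDl sub0r.
apply: (@lt_le_trans _ _ (- `|t|)); last by rewrite lerNl ler_normr lexx orbT.
by rewrite ltrN2; near: t.
Unshelve. all: by end_near. Qed.

(** Directional derivatives reduce to derivatives in one variable, so that
the one-dimensional chain rule applies. *)
Lemma derive_line g z v : 'D_v g z = 'D_1 (fun t : R => g (z + t *: v)) 0.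
Proof.
have H : (fun t : R => t^-1 *: ((g \o shift z) (t *: v) - g z)) =
    (fun t : R => t^-1 *: (((fun t : R => g (z + t *: v)) \o shift 0) (t *: 1) -
      g (z + 0 *: v))).
  by apply/funext => t /=; rewrite scale0r !addr0 [t *: 1]mulr1 (addrC _ z).
by rewrite /derive H.
Qed.

Lemma derivable_line g z v :
  derivable g z v = derivable (fun t : R => g (z + t *: v)) 0 1.
Proof.
have H : (fun t : R => t^-1 *: ((g \o shift z) (t *: v) - g z)) =
    (fun t : R => t^-1 *: (((fun t : R => g (z + t *: v)) \o shift 0) (t *: 1) -
      g (z + 0 *: v))).
  by apply/funext => t /=; rewrite scale0r !addr0 [t *: 1]mulr1 (addrC _ z).
by rewrite /derivable H.
Qed.

Lemma derive_cvg_seq g z v (u : nat -> R) : derivable g z v ->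
  (forall n, u n != 0) -> u @ \oo --> (0 : R) ->
  (u n)^-1 * (g (z + u n *: v) - g z) @[n --> \oo] --> 'D_v g z.
Proof.
move=> dg u0 ucvg.
have dg' : (fun t : R => t^-1 *: ((g \o shift z) (t *: v) - g z)) @ 0^'
    --> ('D_v g z : R) by exact: dg.
have /cvgr_dnbhsP/(_ u (conj u0 ucvg)) H := dg'.
apply: cvg_trans H; apply: near_eq_cvg; near=> n.
by rewrite /= (addrC _ z).
Unshelve. all: by end_near. Qed.

(** As the [i]-th side of the box shrinks to [0], the increments in
[rcons l i] divided by that side tend to the increments in [l] of
[partial i g]. *)
Lemma nonpos_increments_partial l i g : i \notin l ->
  nonpos_increments (rcons l i) g ->
  (forall z, orthant z -> derivable g z 'e_i) ->
  nonpos_increments l (partial i g).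
Proof.
move=> il gl dg s z s0 z0.
pose u n : R := n.+1%:R^-1.
have u0 n : 0 < u n by rewrite invr_gt0.
have H := @increment_cvg l s (fun n y => (u n)^-1 * (g (y + u n *: 'e_i) - g y) + 0)
  (partial i g) z.
have {}H : increment l s (fun y => (u n)^-1 * (g (y + u n *: 'e_i) - g y) + 0) z
    @[n --> \oo] --> increment l s (partial i g) z.
  apply: H => // y y0; under eq_fun do rewrite addr0.
  apply: derive_cvg_seq; first exact: dg.
    by move=> n; rewrite gt_eqF.
  exact: cvg_harmonic.
apply: (cvgr_to_le H); near=> n.
rewrite increment_affine.
pose s' : 'rV[R]_k := \row_j (if j == i then u n else s ord0 j).
have ss' : {in l, forall j, s ord0 j = s' ord0 j}.
  by move=> j jl; rewrite mxE; case: eqP => // ji; move: il; rewrite -ji jl.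
have s'0 : orthant s' by move=> j; rewrite mxE; case: ifP.
have := gl s' z s'0 z0; rewrite increment_rcons -(increment_eq _ _ ss').
rewrite mxE eqxx => le0.
rewrite (_ : (if l is [::] then 0 else 0) = 0 :> R) ?addr0; last by case: (l).
by rewrite pmulr_rle0// invr_gt0.
Unshelve. all: by end_near. Qed.

Lemma foldr_partial_le0 l m g : uniq (l ++ m) ->
  nonpos_increments (l ++ m) g ->
  (forall i m', suffix (i :: m') m -> forall z, orthant z ->
     derivable (foldr partial g m') z 'e_i) ->
  nonpos_increments l (foldr partial g m).
Proof.
elim: m l => [|i m IH] l /=; first by rewrite cats0.
rewrite -cat_rcons => ulm glm dg.
apply: nonpos_increments_partial.
- by move: ulm; rewrite cat_uniq rcons_uniq => /andP[/andP[]].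
- apply: IH => // j m' jm'; apply: dg.
  by apply: suffix_trans jm' _; exact: suffix_cons.
- by apply: dg; exact: suffix_refl.
Qed.

(** Chain rule along the line through [z]: moving by [t] at [s *: z] is moving
by [t / s] at [z]. *)
Lemma partial_scale i g (s c : R) z : 0 < s ->
  (forall y, orthant y -> g (s *: y) = c * g y) ->
  (forall y, orthant y -> derivable g y 'e_i) -> orthant z ->
  partial i g (s *: z) = s^-1 * c * partial i g z.
Proof.
move=> s0 gs dg z0; rewrite /partial.
pose u (t : R) := g (z + t *: 'e_i).
have du : is_derive (0 : R) 1 u ('D_('e_i) g z).
  by split; rewrite /u -?derivable_line -?derive_line//; exact: dg.
have d1 : is_derive (0 : R) 1 (fun t : R => s^-1 * t) s^-1.
  have := @is_deriveZ R R R id s^-1 0 1 1 (is_derive_id _ _).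
  by rewrite /GRing.scale/= mulr1.
have d2 : is_derive (0 : R) 1 (u \o (fun t : R => s^-1 * t)) ('D_('e_i) g z * s^-1).
  by apply: is_derive1_comp => //; rewrite mulr0.
have d3 := @is_deriveZ R R R _ c 0 1 _ d2.
have d4 : is_derive (0 : R) 1 (fun t : R => g (s *: z + t *: 'e_i))
    (c *: ('D_('e_i) g z * s^-1)).
  apply: near_eq_is_derive d3.
  have : \forall t \near (0 : R), orthant (s *: z + t *: 'e_i).
    by apply: near_orthant; exact: orthantZ.
  apply: filterS => t zt; change (c * u (s^-1 * t) = g (s *: z + t *: 'e_i)).
  rewrite /u -gs.
    by rewrite scalerDr scalerA mulrA mulfV ?gt_eqF// mul1r.
  rewrite (_ : _ + _ = s^-1 *: (s *: z + t *: 'e_i)).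
    by apply: orthantZ => //; rewrite invr_gt0.
  by rewrite scalerDr !scalerA mulVf ?gt_eqF// scale1r.
rewrite derive_line derive_val /GRing.scale/=; ring.
Qed.

Lemma foldr_partial_scale m g (s c : R) z : 0 < s ->
  (forall y, orthant y -> g (s *: y) = c * g y) ->
  (forall i m', suffix (i :: m') m -> forall y, orthant y ->
     derivable (foldr partial g m') y 'e_i) -> orthant z ->
  foldr partial g m (s *: z) = s^-1 ^+ size m * c * foldr partial g m z.
Proof.
move=> s0 gs; elim: m z => [|i m IH] z dg z0 /=.
  by rewrite expr0 mul1r gs.
rewrite exprS -[s^-1 * _ * c]mulrA; apply: partial_scale => //.
- move=> y y0; apply: IH => // j m' jm'; apply: dg.
  by apply: suffix_trans jm' _; exact: suffix_cons.
- by apply: dg; exact: suffix_refl.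
Qed.

Lemma enum_set_sorted (tau : {set 'I_k}) :
  sorted (fun i j : 'I_k => (i < j)%N) (enum tau).
Proof.
rewrite /enum_mem; apply: sorted_filter; first by move=> ? ? ?; exact: ltn_trans.
by rewrite -enumT; have := iota_ltn_sorted 0 k; rewrite -val_enum_ord sorted_map.
Qed.

(** A suffix of the increasing enumeration of [tau] is the enumeration of a
smaller set, so [has_mixed_partials] covers every intermediate derivative. *)
Lemma derivable_suffix g (tau : {set 'I_k}) : has_mixed_partials g ->
  forall i m, suffix (i :: m) (enum tau) -> forall z, orthant z ->
    derivable (foldr partial g m) z 'e_i.
Proof.
move=> hg i m /suffixP[m0 etau] z z0.
have tr : transitive (fun i j : 'I_k => (i < j)%N) by move=> ? ? ?; exact: ltn_trans.
have : sorted (fun i j : 'I_k => (i < j)%N) (i :: m).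
  have := enum_set_sorted tau; rewrite etau; apply: subseq_sorted => //.
  exact: suffix_subseq.
rewrite /= path_sortedE// => /andP[im sm].
have em : enum [set j in m] = m.
  apply: (irr_sorted_eq tr) => //.
  - by move=> j; rewrite /= ltnn.
  - exact: enum_set_sorted.
  - by move=> j; rewrite mem_enum inE.
have := hg [set j in m]%SET i; rewrite /mixed_partial em; apply => //.
by move=> j; rewrite inE => jm; exact: (allP im).
Qed.

Lemma mixed_partial_le0 g (tau : {set 'I_k}) z : has_mixed_partials g ->
  (forall l, l != [::] -> uniq l -> nonpos_increments l g) ->
  tau != finset.set0 -> orthant z -> mixed_partial tau g z <= 0.
Proof.
move=> hg gl tau0 z0.
apply: (@foldr_partial_le0 [::] (enum tau) g) (const_mx 1) z _ z0 => /=.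
- exact: enum_uniq.
- apply: gl; last exact: enum_uniq.
  apply: contra tau0 => /eqP etau; apply/eqP/finset.setP => j.
  by rewrite finset.in_set0 -(mem_enum (mem tau)) etau.
- exact: derivable_suffix.
- by move=> i; rewrite mxE.
Qed.

Lemma mixed_partial_scale g (tau : {set 'I_k}) (s c : R) z :
  has_mixed_partials g -> 0 < s ->
  (forall y, orthant y -> g (s *: y) = c * g y) -> orthant z ->
  mixed_partial tau g (s *: z) = s^-1 ^+ #|tau| * c * mixed_partial tau g z.
Proof.
move=> hg s0 gs z0; rewrite cardE; apply: foldr_partial_scale => //.
exact: derivable_suffix.
Qed.

End increments.

(** * Distribution and exponent functions of simple max-stable laws *)

Section max_stable_laws.
Context {R : realType} {k : nat} (P : probability 'rV[R]_k R).
Hypothesis hP : simple_max_stable P.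

Local Notation F := (distribution_function P).
Local Notation V := (exponent_function P).
Implicit Types (z s : 'rV[R]_k) (i : 'I_k) (l : seq 'I_k) (A B : set 'rV[R]_k).

Notation "''e_' i" := (delta_mx ord0 i : 'rV[R]_k) (at level 8, i at level 2, format "''e_' i").

Lemma measurable_row_box (A : 'I_k -> set R) : (forall i, measurable (A i)) ->
  measurable [set x : 'rV[R]_k | forall i, A i (x ord0 i)].
Proof.
move=> mA; rewrite (_ : [set x | _] =
    \big[setI/setT]_(i < k) (fun x : 'rV[R]_k => x ord0 i) @^-1` A i).
  apply: bigsetI_measurable => i _; rewrite -[X in measurable X]setTI.
  exact: measurable_coord.
apply/seteqP; split=> x /=.
  by move=> Ax; rewrite -bigcap_seq => i _; exact: Ax.
by rewrite -bigcap_seq => Ax i; apply: Ax; rewrite /= mem_index_enum.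
Qed.

Lemma measurable_coord_preimage i (B : set R) : measurable B ->
  measurable [set x : 'rV[R]_k | B (x ord0 i)].
Proof.
by move=> mB; rewrite -[X in measurable X]setTI; exact: measurable_coord.
Qed.

Let measurable_le (t : R) : measurable [set u : R | u <= t].
Proof. by rewrite -set_itvNyc; exact: measurable_itv. Qed.

Let measurable_gt (t : R) : measurable [set u : R | t < u].
Proof. by rewrite -set_itvoy; exact: measurable_itv. Qed.

Let measurable_lower z : measurable [set x : 'rV[R]_k | forall i, x ord0 i <= z ord0 i].
Proof. exact: (measurable_row_box (fun i => measurable_le (z ord0 i))). Qed.

Lemma fine_probability_le A B : measurable A -> measurable B -> A `<=` B ->
  fine (P A) <= fine (P B).
Proof.
move=> mA mB AB; apply: fine_le; [exact: fin_num_measure..|].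
by apply: le_measure => //; rewrite inE.
Qed.

Let FE z : (F z)%:E = P [set x | forall i, x ord0 i <= z ord0 i].
Proof.
by rewrite /distribution_function fineK//; apply: fin_num_measure; exact: measurable_lower.
Qed.

Lemma distribution_function_le z z' : (forall i, z ord0 i <= z' ord0 i) -> F z <= F z'.
Proof.
move=> zz'; apply: fine_probability_le; [exact: measurable_lower..|] => x /= xz i.
exact: le_trans (xz i) (zz' i).
Qed.

(** Max-stability evaluated on the lower orthant with corner
[n.+1%:R *: z]. *)
Lemma distribution_function_scale n z : F (n.+1%:R *: z) ^+ n.+1 = F z.
Proof.
pose B := [set x : 'rV[R]_k | forall i, x ord0 i <= (n.+1%:R *: z) ord0 i].
have [_ /(_ n B (measurable_lower _)) HB] := hP.
have eR : pushforward P (fun z => n.+1%:R *: z) B = (F z)%:E.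
  rewrite FE /pushforward; congr (P _); apply/seteqP; split => x /= H i.
    by have := H i; rewrite !mxE ler_pM2l// ltr0n.
  by rewrite !mxE ler_pM2l// ltr0n.
apply: EFin_inj; rewrite -eR -HB /pushforward.
rewrite (_ : _ @^-1` _ = [set x : 'rV['rV[R]_k]_n.+1 | forall j, B (x ord0 j)]).
  rewrite (power_measure_box P (A := fun=> B)); last by move=> _; exact: measurable_lower.
  rewrite (eq_bigr (fun=> (F (n.+1%:R *: z))%:E)); last by move=> j _; rewrite FE.
  by rewrite prodEFin prodr_const card_ord.
apply/seteqP; split => x /= H' i.
  move=> j; have := H' j; rewrite mxE => /bigmax_leP[_ /(_ i isT)]; exact.
by rewrite mxE; apply/bigmax_leP; split => [|j _]; exact: H'.
Qed.

(** The union bound over coordinates, from which all tail estimates come. *)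
Lemma probability_union_le (A : 'I_k -> set 'rV[R]_k) (a : 'I_k -> R) :
  (forall i, measurable (A i)) -> (forall i, (P (A i) <= (a i)%:E)%E) ->
  (P [set x | exists i, A i x] <= (\sum_(i < k) a i)%:E)%E.
Proof.
move=> mA Aa.
have -> : [set x | exists i, A i x] = \big[setU/set0]_(i < k) A i.
  apply/seteqP; split => x /=; rewrite -bigcup_seq.
    by move=> [i Aix]; exists i => //=; rewrite mem_index_enum.
  by move=> [i _ Aix]; exists i.
suff [] : measurable (\big[setU/set0]_(i < k) A i) /\
    (P (\big[setU/set0]_(i < k) A i) <= (\sum_(i < k) a i)%:E)%E by [].
elim/big_ind2 : _ => [|B b B' b' [mB Bb] [mB' B'b']|i _] //.
  by rewrite measure0.
split; first exact: measurableU.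
by apply: (le_trans (measureU2 _ mB mB')); rewrite EFinD leeD.
Qed.

Lemma measurable_coord_gt i (t : R) : measurable [set x : 'rV[R]_k | t < x ord0 i].
Proof. exact: (measurable_coord_preimage i (measurable_gt t)). Qed.

Lemma measurable_coord_le i (t : R) : measurable [set x : 'rV[R]_k | x ord0 i <= t].
Proof. exact: (measurable_coord_preimage i (measurable_le t)). Qed.

Lemma probability_coord_gt i (t : R) : 0 < t ->
  (P [set x | (t < x ord0 i)%R] <= (t^-1)%:E)%E.
Proof.
move=> t0.
rewrite (_ : [set x | _] = ~` [set x | x ord0 i <= t]); last first.
  apply/seteqP; split => x /=; first by rewrite ltNge => /negP.
  by move=> /negP; rewrite -ltNge.
rewrite probability_setC; last exact: measurable_coord_le.
have [-> // _] := hP.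
rewrite -EFinB lee_fin mulN1r lerBlDr addrC -lerBlDr.
exact: expR_ge1Dx.
Qed.

Lemma distribution_function_ge z : orthant z ->
  1 - \sum_(i < k) (z ord0 i)^-1 <= F z.
Proof.
move=> z0.
pose C := [set x : 'rV[R]_k | exists i, z ord0 i < x ord0 i].
have eC : [set x : 'rV[R]_k | forall i, x ord0 i <= z ord0 i] = ~` C.
  apply/seteqP; split => x /= H.
    by move=> [i]; rewrite ltNge H.
  by move=> i; rewrite leNgt; apply/negP => xi; apply: H; exists i.
have mC : measurable C.
  by rewrite -[C]setCK -eC; apply: measurableC; exact: measurable_lower.
have PC : (P C <= (\sum_(i < k) (z ord0 i)^-1)%:E)%E.
  apply: (@probability_union_le (fun i => [set x | z ord0 i < x ord0 i])).
    by move=> i; exact: measurable_coord_gt.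
  by move=> i; exact: probability_coord_gt.
rewrite -lee_fin FE (_ : P _ = P (~` C)); last by congr (P _); exact: eC.
rewrite probability_setC// EFinB.
exact: leeB.
Qed.

(** [F z] is a power of [F (n *: z)], which is close to [1] for [n] large. *)
Lemma distribution_function_gt0 z : orthant z -> 0 < F z.
Proof.
move=> z0; pose S := \sum_(i < k) (z ord0 i)^-1.
pose n := Num.truncn S.
rewrite -(distribution_function_scale n z) exprn_gt0//.
apply: lt_le_trans (distribution_function_ge _); last exact: orthantZ.
rewrite (eq_bigr (fun i => n.+1%:R^-1 * (z ord0 i)^-1)); last first.
  by move=> i _; rewrite mxE invfM.
rewrite -mulr_sumr -/S subr_gt0 mulrC ltr_pdivrMr// mul1r.
have : 0 <= S by apply: sumr_ge0 => i _; rewrite invr_ge0 ltW// z0.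
by move=> /Num.Theory.truncn_itv /andP[].
Qed.

Lemma expRN_exponent_function z : orthant z -> expR (- V z) = F z.
Proof. by move=> z0; rewrite /exponent_function opprK lnK// posrE distribution_function_gt0. Qed.

Lemma exponent_function_le z z' : orthant z ->
  (forall i, z ord0 i <= z' ord0 i) -> V z' <= V z.
Proof.
move=> z0 zz'; have F0 := distribution_function_gt0 z0.
have FF := distribution_function_le zz'.
by rewrite lerN2 ler_ln ?posrE// (lt_le_trans F0).
Qed.

Lemma exponent_function_scale_nat n z : orthant z -> V (n.+1%:R *: z) = V z / n.+1%:R.
Proof.
move=> z0; rewrite /exponent_function -(distribution_function_scale n z).
rewrite lnXn; last by apply: distribution_function_gt0; exact: orthantZ.
by rewrite -(mulr_natr (ln _)) -mulNr mulfK// pnatr_eq0.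
Qed.

Lemma exponent_function_gt0 (i : 'I_k) z : orthant z -> 0 < V z.
Proof.
move=> z0; rewrite oppr_gt0 ln_lt0// distribution_function_gt0//=.
have : F z <= expR (- 1 / z ord0 i).
  have [hm _] := hP; rewrite -lee_fin FE -(hm i _ (z0 i)); apply: le_measure.
  - rewrite inE; exact: measurable_lower.
  - rewrite inE; exact: measurable_coord_le.
  - by move=> x /= /(_ i).
move=> /le_lt_trans; apply; rewrite expR_lt1 mulN1r oppr_lt0 invr_gt0.
exact: z0.
Qed.

(** Integer scaling gives rational scaling, and [V] decreases along rays: if the
inequality failed, a fraction [a / b.+1] in between [V z / V (s *: z)] and [s]
would contradict monotonicity. *)
Let exponent_function_scale_le (i : 'I_k) (s : R) z : 0 < s -> orthant z ->
  V (s *: z) <= s^-1 * V z.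
Proof.
move=> s0 z0; rewrite leNgt; apply/negP => lt1.
have V0 := exponent_function_gt0 i z0.
have Vs0 : 0 < V (s *: z) by apply: (exponent_function_gt0 i); exact: orthantZ.
have vs : V z / V (s *: z) < s by rewrite ltr_pdivrMr// -ltr_pdivrMl.
pose b := Num.truncn ((s - V z / V (s *: z))^-1).
have /andP[_ hb] : (b%:R <= (s - V z / V (s *: z))^-1 < b.+1%:R).
  by apply: truncn_itv; rewrite invr_ge0 subr_ge0 ltW.
have b0 : 0 < b.+1%:R :> R by rewrite ltr0n.
pose a := Num.truncn (s * b.+1%:R).
have /andP[ha ha'] : a%:R <= s * b.+1%:R < a.+1%:R.
  by apply: truncn_itv; rewrite mulr_ge0// ltW.
have {}hb : V z / V (s *: z) * b.+1%:R + 1 < s * b.+1%:R.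
  have : 1 < b.+1%:R * (s - V z / V (s *: z)).
    by rewrite -ltr_pdivrMr ?subr_gt0// mul1r.
  lra.
have aS : a.+1%:R = a%:R + 1 :> R by rewrite -natr1.
have ab : V z / V (s *: z) * b.+1%:R < a%:R by move: hb ha'; rewrite aS; lra.
have a0 : 0 < a%:R :> R by apply: le_lt_trans ab; rewrite mulr_ge0// ltW// divr_gt0.
have := a0; rewrite ltr0n => a0'.
have qz0 : orthant ((a%:R / b.+1%:R) *: z) by apply: orthantZ => //; rewrite divr_gt0.
have : V (s *: z) <= V ((a%:R / b.+1%:R) *: z).
  apply: exponent_function_le => // j; rewrite !mxE ler_wpM2r//.
    by apply: ltW; exact: z0.
  by rewrite ler_pdivrMr.
have e1 : V ((a%:R / b.+1%:R) *: z) / b.+1%:R = V z / a%:R.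
  rewrite -exponent_function_scale_nat// scalerA mulrC divfK ?gt_eqF//.
  by rewrite -(prednK a0') exponent_function_scale_nat.
have -> : V ((a%:R / b.+1%:R) *: z) = V z / a%:R * b.+1%:R.
  by rewrite -e1 divfK// gt_eqF.
apply/negP; rewrite -ltNge.
have {}ab : V z * b.+1%:R < a%:R * V (s *: z).
  by move: ab; rewrite mulrAC ltr_pdivrMr.
by rewrite mulrAC ltr_pdivrMr// [ltRHS]mulrC.
Qed.

(** The reverse inequality is the first one applied at [s *: z] with factor
[s^-1]. *)
Lemma exponent_function_scale (i : 'I_k) (s : R) z : 0 < s -> orthant z ->
  V (s *: z) = s^-1 * V z.
Proof.
move=> s0 z0; apply/eqP; rewrite eq_le exponent_function_scale_le//=.
have s'0 : 0 < s^-1 by rewrite invr_gt0.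
have sz0 := orthantZ s0 z0.
have := exponent_function_scale_le i s'0 sz0.
by rewrite scalerA mulVf ?gt_eqF// scale1r invrK -ler_pdivrMl.
Qed.

(** Since [F (n *: z) = exp (- V z / n)], the sequence [n (1 - F (n *: z))]
tends to [V z]; the elementary bounds [1 - u <= exp (- u) <= 1 - u + u ^+ 2]
give a squeeze.  The expression is affine in [F], as
[increment_affine] requires. *)
Lemma exponent_function_cvg z : orthant z ->
  - n.+1%:R * F (n.+1%:R *: z) + n.+1%:R @[n --> \oo] --> V z.
Proof.
move=> z0; set v := V z.
have H0 : 0 <= v.
  rewrite oppr_ge0 ln_le0//; rewrite -lee_fin FE; apply: probability_le1; exact: measurable_lower.
apply: (@squeeze_cvgr _ _ _ _ (fun n => v - v ^+ 2 * n.+1%:R^-1) (fun=> v)).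
- near=> n.
  have n0 : 0 < n.+1%:R :> R by rewrite ltr0n.
  rewrite -expRN_exponent_function; last exact: orthantZ.
  rewrite exponent_function_scale_nat// -/v.
  pose u := v / n.+1%:R.
  have u0 : 0 <= u by rewrite divr_ge0.
  have vE : v = u * n.+1%:R by rewrite /u divfK// gt_eqF.
  rewrite -/u.
  have e1 : 1 - u <= expR (- u) by exact: expR_ge1Dx.
  have e2 : expR (- u) <= 1 - u + u ^+ 2.
    have : 1 + u <= expR u by exact: expR_ge1Dx.
    have : expR (- u) * expR u = 1 by rewrite -expRD addNr expR0.
    have := expR_gt0 (- u); set x := expR (- u); set y := expR u => x0 xy uy.
    have : x * (1 + u) <= 1 by rewrite -[leRHS]xy ler_wpM2l// ltW.
    have : 0 <= u ^+ 3 by rewrite exprn_ge0.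
    move=> u3 xu.
    have : x * (1 + u) <= (1 - u + u ^+ 2) * (1 + u).
      by apply: le_trans xu _; rewrite (_ : _ * _ = 1 + u ^+ 3); [lra|ring].
    by rewrite ler_pM2r// ltr_pwDl.
  have -> : v ^+ 2 * n.+1%:R^-1 = u ^+ 2 * n.+1%:R.
    by rewrite vE; field; rewrite gt_eqF.
  have := ler_wpM2l (ltW n0) e1; have := ler_wpM2l (ltW n0) e2.
  rewrite vE => le2 le1.
  by apply/andP; split; lra.
- rewrite -[X in _ --> X]subr0; apply: cvgB; first exact: cvg_cst.
  rewrite -[X in _ --> X](mulr0 (v ^+ 2)); apply: cvgM; first exact: cvg_cst.
  exact: cvg_harmonic.
- exact: cvg_cst.
Unshelve. all: by end_near. Qed.

Lemma exponent_function_le_sum z : orthant z -> V z <= \sum_(i < k) (z ord0 i)^-1.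
Proof.
move=> z0; apply: (cvgr_to_le (exponent_function_cvg z0)); near=> n.
have := distribution_function_ge (orthantZ (ltr0Sn R n) z0).
rewrite (eq_bigr (fun i => n.+1%:R^-1 * (z ord0 i)^-1)); last first.
  by move=> i _; rewrite mxE invfM.
rewrite -mulr_sumr; set S := \sum_(i < k) _; set f := F _ => H.
have n0 : 0 < n.+1%:R :> R by rewrite ltr0n.
have : n.+1%:R * (1 - n.+1%:R^-1 * S) <= n.+1%:R * f by rewrite ler_pM2l.
rewrite mulrBr mulrA mulfV ?gt_eqF//; lra.
Unshelve. all: by end_near. Qed.

(** The half-open box whose probability is the increment of the distribution
function, lower orthants being used in the coordinates outside of [l]. *)
Let box l s z := [set x : 'rV[R]_k | forall i,
  x ord0 i <= z ord0 i + (i \in l)%:R * s ord0 i /\ (i \in l -> z ord0 i < x ord0 i)].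

Let measurable_box l s z : measurable (box l s z).
Proof.
apply: (measurable_row_box (A := fun i => [set u | u <= z ord0 i + (i \in l)%:R * s ord0 i /\
  (i \in l -> z ord0 i < u)])) => i.
case: (i \in l); last first.
  rewrite (_ : [set u | _] = [set u | u <= z ord0 i + false%:R * s ord0 i])//.
  by apply/seteqP; split => u //= -[].
rewrite (_ : [set u | _] = [set u | u <= z ord0 i + true%:R * s ord0 i] `&` [set u | z ord0 i < u]).
  exact: measurableI.
by apply/seteqP; split => u /= -[? zu]; split => //; exact: zu.
Qed.

Lemma increment_distribution_function l s z : uniq l -> orthant s ->
  increment l s F z = fine (P (box l s z)).
Proof.
move=> + s0; elim: l z => [|i l IH] z /=.
  move=> _; rewrite /distribution_function; congr (fine (P _)).
  apply/seteqP; split => x /= H j; first by rewrite in_nil mul0r addr0.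
  by have [] := H j; rewrite in_nil mul0r addr0.
move=> /andP[il ul]; rewrite !IH//.
have -> : box l s (z + s ord0 i *: 'e_i) = box l s z `|` box (i :: l) s z.
  have zi j : j != i -> (z + s ord0 i *: 'e_i) ord0 j = z ord0 j.
    by move=> ji; rewrite !mxE (negbTE ji) andbF mulr0 addr0.
  have zii : (z + s ord0 i *: 'e_i) ord0 i = z ord0 i + s ord0 i.
    by rewrite !mxE !eqxx mulr1.
  apply/seteqP; split => x /=.
    move=> H; have [xi|xi] := leP (x ord0 i) (z ord0 i); [left|right] => j.
      have [->|ji] := eqVneq j i; last by have := H j; rewrite zi.
      by rewrite (negbTE il) mul0r addr0.
    have [->|ji] := eqVneq j i.
      by have [+ _] := H i; rewrite zii mem_head (negbTE il) mul0r addr0 mul1r.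
    by have := H j; rewrite zi// in_cons (negbTE ji).
  move=> [H|H] j.
    have [->|ji] := eqVneq j i; last by have := H j; rewrite zi.
    rewrite zii (negbTE il) mul0r addr0; split => //.
    have [+ _] := H i; rewrite (negbTE il) mul0r addr0 => /le_trans; apply.
    by rewrite lerDl ltW// s0.
  have [->|ji] := eqVneq j i.
    have [+ _] := H i; rewrite zii mem_head (negbTE il) mul0r addr0 mul1r.
    by split.
  by have := H j; rewrite zi// in_cons (negbTE ji).
rewrite measureU//; last first.
  apply/seteqP; split => // x [/= H H'].
  have [+ _] := H i; have [_ /(_ (mem_head _ _))] := H' i.
  by rewrite (negbTE il) mul0r addr0 ltNge => /negP.
rewrite fineD; [|exact: fin_num_measure..].
by rewrite addrC addKr.
Qed.

(** [V] is a limit of functions [n - n F (n *: z)], whose increments are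
opposite to probabilities. *)
Lemma exponent_function_nonpos_increments l : l != [::] -> uniq l ->
  nonpos_increments l V.
Proof.
move=> l0 ul s z s0 z0.
apply: (cvgr_to_le (increment_cvg exponent_function_cvg s0 z0)); near=> n.
rewrite increment_affine increment_scale.
rewrite (_ : (if l is [::] then _ else _) = 0) ?addr0; last by case: (l) l0.
rewrite increment_distribution_function//; last exact: orthantZ.
by rewrite mulNr oppr_le0 mulr_ge0// fine_ge0.
Unshelve. all: by end_near. Qed.

Lemma probability_outside_box_le (a b : R) : 0 < a -> 0 < b ->
  (P (~` [set x | forall i, (a <= x ord0 i <= b)%R]) <=
   (k%:R * (expR (- 1 / a) + b^-1))%:E)%E.
Proof.
move=> a0 b0.
pose A i := [set x : 'rV[R]_k | x ord0 i <= a] `|` [set x | b < x ord0 i].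
have mA i : measurable (A i).
  by apply: measurableU; [exact: measurable_coord_le|exact: measurable_coord_gt].
have PA i : (P (A i) <= (expR (- 1 / a) + b^-1)%:E)%E.
  apply: le_trans (measureU2 _ _ _) _; [exact: measurable_coord_le|exact: measurable_coord_gt|].
  rewrite EFinD; apply: leeD; last exact: probability_coord_gt.
  have [hm _] := hP; have := hm i _ a0; move=> <-; exact: lexx.
have := probability_union_le mA PA.
rewrite sumr_const card_ord mulr_natl; apply: le_trans; apply: le_measure.
- rewrite inE; apply: measurableC.
  apply: (measurable_row_box (A := fun=> [set u | a <= u <= b])) => i.
  rewrite -set_itvcc; exact: measurable_itv.
- rewrite inE (_ : [set x | _] = \big[setU/set0]_(i < k) A i).
    by apply: bigsetU_measurable.
  apply/seteqP; split => x /=; rewrite -bigcup_seq.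
    by move=> [i Aix]; exists i => //=; rewrite mem_index_enum.
  by move=> [i _ Aix]; exists i.
- move=> x /= /existsNP[i /negP]; rewrite negb_and -!ltNge => /orP[xa|bx].
    by exists i; left; exact: ltW.
  by exists i; right.
Qed.

End max_stable_laws.

(** * Gradients and norms in coordinates *)

Section gradients.
Context {R : realType} {D : nat}.
Implicit Types (g : 'rV[R]_D -> R) (x v : 'rV[R]_D).

Lemma norm_coord_le v i : `|v ord0 i| <= `|v|.
Proof.
by rewrite [leRHS]/Num.norm /= mx_normrE; apply/bigmax_geP; right => /=; exists (ord0, i).
Qed.

Lemma derive_gradient g x v : differentiable g x ->
  'D_v g x = \sum_(i < D) v ord0 i * gradient g x ord0 i.
Proof.
move=> dg; rewrite deriveE// [v in LHS]row_sum_delta linear_sum/=.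
apply: eq_bigr => i _; rewrite linearZ/= mxE deriveE//.
Qed.

Lemma derive_le_gradient g x v : differentiable g x ->
  `|'D_v g x| <= D%:R * `|gradient g x| * `|v|.
Proof.
move=> dg; rewrite derive_gradient//; apply: le_trans (ler_norm_sum _ _ _) _.
rewrite -[X in X%:R](card_ord D) mulr_natl mulrnAl -sumr_const.
apply: ler_sum => i _; rewrite normrM mulrC ler_pM//; exact: norm_coord_le.
Qed.

(** The difference quotients along [x + w / n] are nonpositive for every
direction [w], and the derivative is odd in the direction. *)
Lemma derive_at_local_max g x v : differentiable g x ->
  (\near x, g x <= 0) -> g x = 0 -> 'D_v g x = 0.
Proof.
move=> dg g0 gx0.
have le0 w : 'D_w g x <= 0.
  have ncvg : x + n.+1%:R^-1 *: w @[n --> \oo] --> x.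
    rewrite -[X in _ --> X]addr0 -[X in _ --> x + X](scale0r w).
    by apply: cvgD; [exact: cvg_cst|apply: cvgZr_tmp; exact: cvg_harmonic].
  have := @derive_cvg_seq R D g x w (fun n => n.+1%:R^-1) (diff_derivable dg).
  move=> /(_ (fun n => invr_neq0 (lt0r_neq0 (ltr0Sn R n))) cvg_harmonic) H.
  apply: (cvgr_to_le H); near=> n.
  rewrite invrK gx0 subr0 pmulr_rle0//; near: n; exact: ncvg g0.
apply/eqP; rewrite eq_le le0/=; have := le0 (- v).
by rewrite !deriveE// linearN oppr_le0.
Unshelve. all: by end_near. Qed.

(** The hypothesis on [(g x)^-1] is void at a zero of [g]; there the sign of
[g] makes [x] a local maximum, and the derivative vanishes. *)
Lemma log_lip_oppr g x (c : R) : differentiable g x -> (\near x, g x <= 0) ->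
  `|(g x)^-1 *: gradient g x| <= c -> log_lip (D%:R * c) (fun t => - g t) x.
Proof.
move=> dg g0 gc; have gx0 : g x <= 0 := nbhs_singleton g0.
split; first exact: differentiableN.
  by rewrite oppr_ge0.
move=> v; rewrite (_ : (fun _ => _) = - g)// deriveN ?normrN; last exact: diff_derivable.
have [gx|gx] := eqVneq (g x) 0.
  by rewrite derive_at_local_max// gx oppr0 mulr0 normr0.
apply: le_trans (derive_le_gradient _ dg) _.
rewrite -!mulrA ler_wpM2l// [leRHS]mulrCA mulrC ler_wpM2l//.
by rewrite -(ler0_norm gx0) -ler_pdivrMr ?normr_gt0// mulrC -normfV -normrZ.
Qed.

(** The logarithmic derivative of [exp (- a V)] is [- a V] times the one of
[V]. *)
Lemma log_lip_expRN (V : 'rV[R]_D -> R) x (a c : R) : 0 <= a ->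
  (\near x, 0 < V x) -> differentiable (fun t => ln (V t)) x ->
  `|gradient (fun t => ln (V t)) x| <= c ->
  log_lip (D%:R * c * (a * V x)) (fun t => expR (- (a * V t))) x.
Proof.
move=> a0 V0 dl lc; have Vx := nbhs_singleton V0.
have dW' : differentiable (fun t => - ln (V t)) x by exact: differentiableN.
have [dW eW] := differentiable_expRNE dW'.
have VW : \near x, expR (- (- ln (V x))) = V x.
  by apply: filterS V0 => t Vt; rewrite opprK lnK.
have dV : differentiable V x by exact: near_eq_differentiable dW.
have daV : differentiable (fun t => a * V t) x by exact: (differentiableZ a dV).
have [dE eE] := differentiable_expRNE daV.
split => // v; rewrite eE normrN normrM (ger0_norm (expR_ge0 _)) ler_wpM2r ?expR_ge0//.
rewrite (_ : (fun _ => _) = a *: V)// deriveZ; last exact: diff_derivable.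
rewrite /GRing.scale/= normrM (ger0_norm a0).
rewrite -(near_eq_derive v VW) eW (nbhs_singleton VW).
rewrite (_ : (fun _ => _) = - (fun t => ln (V t)))// deriveN; last exact: diff_derivable.
rewrite mulNr opprK normrM (gtr0_norm Vx).
rewrite [leRHS](_ : _ = a * ((D%:R * c * `|v|) * V x)); last by ring.
rewrite ler_wpM2l// ler_wpM2r ?(ltW Vx)//.
by apply: le_trans (derive_le_gradient _ dl) _; rewrite ler_wpM2r// ler_wpM2l.
Qed.

End gradients.

Section norms.
Context {R : realType} {k : nat} (N : 'rV[R]_k -> R).
Hypothesis hN : is_norm N.

Lemma is_norm_ge0 z : 0 <= N z.
Proof.
have [tri hom _] := hN.
have N0 : N 0 = 0 by rewrite -(scale0r 0) hom normr0 mul0r.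
have := tri z (- z); rewrite subrr N0 -scaleN1r hom normrN1 mul1r; lra.
Qed.

Lemma is_norm_gt0 z : z != 0 -> 0 < N z.
Proof.
move=> z0; rewrite lt_neqAle is_norm_ge0 andbT eq_sym.
by apply: contra z0 => /eqP; have [_ _ h] := hN => /h ->.
Qed.

Lemma is_norm_le (z : 'rV[R]_k) (b : R) : (forall i, `|z ord0 i| <= b) ->
  N z <= (\sum_(i < k) N (delta_mx ord0 i)) * b.
Proof.
move=> zb; have [tri hom _] := hN; rewrite [z in leLHS]row_sum_delta mulr_suml.
elim/big_ind2 : _ => [|a A b' B aA bB|i _].
- by rewrite -(scale0r 0) hom normr0 mul0r.
- by apply: le_trans (tri _ _) _; exact: lerD.
- by rewrite hom mulrC ler_wpM2l// is_norm_ge0.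
Qed.

End norms.

(** * Logarithmic derivatives of max-stable densities *)

Lemma powRXn (R : realType) (x a : R) n : 0 <= x -> (x ^+ n) `^ a = (x `^ a) ^+ n.
Proof.
by move=> x0; rewrite -powR_mulrn// -powRrM mulrC powRrM powR_mulrn// powR_ge0.
Qed.

Section max_stable_family.
Context {R : realType} {D k : nat}.
Variables (P : 'rV[R]_D -> probability 'rV[R]_k R) (U : set 'rV[R]_D).
Let V t := exponent_function (P t).
Hypothesis openU : open U.
Hypothesis hms : forall t, U t -> simple_max_stable (P t).
Hypothesis hmp : forall t, U t -> has_mixed_partials (V t).
Variables (N : 'rV[R]_k -> R) (A alpha : R).
Hypothesis hN : is_norm N.
Hypothesis A0 : 0 < A.
Hypothesis alpha0 : 0 <= alpha.
Let c (z : 'rV[R]_k) := A * \sum_(i < k) z ord0 i `^ (- alpha).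
Hypothesis hV : forall t z, U t -> orthant z -> N z = 1 ->
  differentiable (fun t => ln (V t z)) t /\
  `| gradient (fun t => ln (V t z)) t | <= c z.
Hypothesis hmixed : forall t z (tau : {set 'I_k}),
  U t -> orthant z -> N z = 1 -> tau != finset.set0 ->
  differentiable (fun t => mixed_partial tau (V t) z) t /\
  `| (mixed_partial tau (V t) z)^-1 *:
     gradient (fun t => mixed_partial tau (V t) z) t | <= c z.
Variable i0 : 'I_k.

Let K := size (index_enum {set 'I_k}).

Lemma is_norm_orthant_gt0 z : orthant z -> 0 < N z.
Proof.
move=> z0; apply: is_norm_gt0 => //; apply/eqP => z00.
by have := z0 i0; rewrite z00 mxE ltxx.
Qed.

Let c_ge0 z : 0 <= c z.
Proof.
by apply: mulr_ge0; [exact: ltW|apply: sumr_ge0 => i _; exact: powR_ge0].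
Qed.

(** Homogeneity moves the hypotheses from [(N z)^-1 *: z], which has norm [1],
to [z].  The factor [expR (- V)] contributes [V z], bounded by the sum of the
[(z ord0 i)^-1], and a product over a partition contributes at most [K], which
bounds the number of blocks. *)
Lemma log_lip_max_stable_density z t : U t -> orthant z ->
  log_lip (D%:R * c ((N z)^-1 *: z) * (\sum_(i < k) (z ord0 i)^-1 + K%:R))
    (fun t => max_stable_density (V t) z) t.
Proof.
move=> Ut z0; set s := N z; have s0 : 0 < s by exact: is_norm_orthant_gt0.
set z1 := s^-1 *: z.
have z10 : orthant z1 by apply: orthantZ => //; rewrite invr_gt0.
have Nz1 : N z1 = 1.
  have [_ hom _] := hN.
  by rewrite hom ger0_norm ?invr_ge0 ?(ltW s0)// mulVf// gt_eqF.
have zE : z = s *: z1 by rewrite scalerA mulfV ?gt_eqF// scale1r.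
have nearU : \near t, U t by exact: open_nbhs_nbhs.
have Vs t' : U t' -> forall y, orthant y -> V t' (s *: y) = s^-1 * V t' y.
  by move=> Ut' y y0; exact: (exponent_function_scale (hms Ut') i0).
have C0 : 0 <= D%:R * c z1 by rewrite mulr_ge0.
have lip_mixed tau : tau != finset.set0 ->
    log_lip (D%:R * c z1) (fun t => - mixed_partial tau (V t) z) t.
  move=> tau0; have [dm gm] := hmixed Ut z10 Nz1 tau0.
  pose kappa := s^-1 ^+ #|tau| * s^-1.
  have kappa0 : 0 <= kappa by rewrite mulr_ge0 ?exprn_ge0// invr_ge0 ltW.
  have m0 : \near t, mixed_partial tau (V t) z1 <= 0.
    apply: filterS nearU => t' Ut'; apply: mixed_partial_le0 => //.
      exact: hmp.
    by move=> l; exact: exponent_function_nonpos_increments (hms Ut') _.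
  apply: (@log_lip_near _ _ _ (fun t => kappa * - mixed_partial tau (V t) z1)).
    apply: filterS nearU => t' Ut'; rewrite [in RHS]zE.
    by rewrite (mixed_partial_scale _ (hmp Ut') s0 (Vs _ Ut') z10) mulrN.
  rewrite -[D%:R * _]add0r; apply: log_lipM; first exact: log_lip_cst.
  exact: log_lip_oppr.
have lip_exp : log_lip (D%:R * c z1 * V t z) (fun t => expR (- V t z)) t.
  have [dl gl] := hV Ut z10 Nz1.
  rewrite [in X in log_lip X]zE Vs//.
  apply: (@log_lip_near _ _ _ (fun t => expR (- (s^-1 * V t z1)))).
    by apply: filterS nearU => t' Ut'; rewrite -Vs// -zE.
  apply: log_lip_expRN => //; first by rewrite invr_ge0 ltW.
  by apply: filterS nearU => t' Ut'; exact: exponent_function_gt0 (hms Ut') i0 _ z10.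
rewrite (_ : (fun t => max_stable_density (V t) z) = fun t =>
    \sum_(p : {set {set 'I_k}} | finset.partition p [set: 'I_k]%SET)
     expR (- V t z) * \prod_(tau in p) (- mixed_partial tau (V t) z)); last first.
  by apply/funext => t'; rewrite /max_stable_density patchE mem_set.
apply: log_lip_sum.
  by rewrite mulr_ge0// addr_ge0// sumr_ge0// => i _; rewrite invr_ge0 ltW// z0.
move=> p /and3P[_ _ p0].
apply: (@log_lip_le _ _ (D%:R * c z1 * V t z + K%:R * (D%:R * c z1))).
  rewrite [K%:R * _]mulrC -mulrDr ler_wpM2l// lerD2r.
  exact: exponent_function_le_sum (hms Ut) _ z0.
apply: log_lipM => //; apply: log_lip_prod => // tau taup; apply: lip_mixed.
by apply: contra p0 => /eqP <-.
Qed.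

(** On the box the coordinates of [(N z)^-1 *: z] are at least
[2 ^- n / (S * 2 ^ (m n))], as [N z] is at most [S] times the largest
coordinate. *)
Lemma angular_bound_le (m n : nat) (z : 'rV[R]_k) (S := \sum_(i < k) N (delta_mx ord0 i)) :
  (forall i, (2 ^+ n)^-1 <= z ord0 i <= (2 ^+ m) ^+ n) ->
  c ((N z)^-1 *: z) * (\sum_(i < k) (z ord0 i)^-1 + K%:R) <=
  (A * k%:R * S `^ alpha * (k%:R + K%:R)) * (2 * (2 ^+ m.+1) `^ alpha) ^+ n.
Proof.
move=> Ez.
have p2 j : 0 < 2 ^+ j :> R by rewrite exprn_gt0.
have z0 i : 0 < z ord0 i.
  by have /andP[+ _] := Ez i; apply: lt_le_trans; rewrite invr_gt0.
have zinv i : (z ord0 i)^-1 <= 2 ^+ n.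
  by have /andP[+ _] := Ez i; rewrite -[X in _ -> _ <= X]invrK lef_pV2 ?posrE ?invr_gt0.
have S0 : 0 <= S by apply: sumr_ge0 => i _; exact: is_norm_ge0.
have s0 : 0 < N z by exact: is_norm_orthant_gt0.
have Nz : N z <= S * (2 ^+ m) ^+ n.
  apply: is_norm_le => // i; rewrite ger0_norm; last exact: ltW.
  by have /andP[] := Ez i.
have coord i : ((N z)^-1 *: z) ord0 i `^ (- alpha) <=
    S `^ alpha * ((2 ^+ m.+1) `^ alpha) ^+ n.
  rewrite -mulN1r powRrM powR_inv1; last by rewrite mxE ltW// mulr_gt0// invr_gt0.
  have -> : S `^ alpha * ((2 ^+ m.+1) `^ alpha) ^+ n = (S * (2 ^+ m.+1) ^+ n) `^ alpha.
    rewrite (powRM _ S0 (exprn_ge0 _ (ltW (p2 _)))).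
    by rewrite [in RHS](@powRXn _ (2 ^+ m.+1)) ?exprn_ge0.
  apply: ge0_ler_powR => //.
  - by rewrite nnegrE mxE invr_ge0 ltW// mulr_gt0// invr_gt0.
  - by rewrite nnegrE mulr_ge0// !exprn_ge0.
  rewrite mxE invfM invrK exprS exprMn [2 ^+ n * _]mulrC mulrA.
  by apply: ler_pM => //; rewrite ?invr_ge0 ltW.
have B0 : 0 <= S `^ alpha * ((2 ^+ m.+1) `^ alpha) ^+ n.
  by rewrite mulr_ge0 ?exprn_ge0 ?powR_ge0.
have le1 : c ((N z)^-1 *: z) <= A * (k%:R * (S `^ alpha * ((2 ^+ m.+1) `^ alpha) ^+ n)).
  rewrite ler_wpM2l ?(ltW A0)//; apply: le_trans (ler_sum _ (fun i _ => coord i)) _.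
  by rewrite sumr_const card_ord mulr_natl.
have le2 : \sum_(i < k) (z ord0 i)^-1 + K%:R <= (k%:R + K%:R) * 2 ^+ n.
  rewrite mulrDl lerD//.
    apply: le_trans (ler_sum _ (fun i _ => zinv i)) _.
    by rewrite sumr_const card_ord mulr_natl.
  by rewrite ler_peMr// exprn_ege1// ler1n.
apply: le_trans (ler_pM (c_ge0 _) _ le1 le2) _.
  by rewrite addr_ge0// sumr_ge0// => i _; rewrite invr_ge0 ltW.
by rewrite exprMn; lra.
Qed.

End max_stable_family.

(** * Summability of the tail bounds *)

Section tails.
Context {R : realType}.

Lemma nneseries_geometric_lty (a q : R) : 0 <= a -> 0 <= q < 1 ->
  (\sum_(0 <= n <oo) (a * q ^+ n)%:E < +oo)%E.
Proof.
move=> a0 /andP[q0 q1].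
have : series (geometric a q) @ \oo --> a / (1 - q).
  by apply: cvg_geometric_series; rewrite ger0_norm.
move=> H; rewrite (_ : (\sum_(0 <= n <oo) _)%E = (a / (1 - q))%:E) ?ltry//.
apply: cvg_lim => //.
rewrite (_ : (fun n => _) = EFin \o series (geometric a q)).
  by apply: cvg_EFin H; near=> n.
by apply/funext => n /=; rewrite sumEFin.
Unshelve. all: by end_near. Qed.

(** The left tail of a Frechet margin is super-exponential, but only its
polynomial decay is used. *)
Lemma expRN_le (x : R) m : 0 < x -> expR (- x) <= m.+1`!%:R / x ^+ m.+1.
Proof.
move=> x0; rewrite expRN -[leRHS]invrK lef_pV2 ?posrE ?expR_gt0//; last first.
  by rewrite invr_gt0 divr_gt0 ?exprn_gt0// ltr0n fact_gt0.
rewrite invfM invrK mulrC; apply: le_trans (expR_ge1Dxn m (ltW x0)).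
by rewrite lerDr.
Qed.

(** With [m.+1] in the role of the growth exponent of the boxes, the inequality
reads [2 + 2 alpha (m + 2) < m + 1], which is solvable because
[2 alpha < 1]. *)
Lemma exists_tail_exponent (alpha : R) : 0 <= alpha < 1 / 2 ->
  exists m : nat, (2 * (2 ^+ m.+2) `^ alpha) ^+ 2 / 2 ^+ m.+1 < 1.
Proof.
move=> /andP[a0 a1].
pose m := Num.truncn ((2 + 2 * alpha) / (1 - 2 * alpha)).
exists m; rewrite ltr_pdivrMr ?exprn_gt0// mul1r.
have /andP[_ hm] : m%:R <= (2 + 2 * alpha) / (1 - 2 * alpha) < m.+1%:R.
  by apply: truncn_itv; rewrite divr_ge0; lra.
have {}hm : 2 + (m.+2%:R * alpha) * 2 < m.+1%:R.
  have : 2 + 2 * alpha < m.+1%:R * (1 - 2 * alpha) by rewrite -ltr_pdivrMr//; lra.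
  have -> : m.+2%:R = m.+1%:R + 1 :> R by rewrite natr1.
  lra.
have -> : (2 * (2 ^+ m.+2) `^ alpha) ^+ 2 = 2 `^ (2 + (m.+2%:R * alpha) * 2) :> R.
  rewrite powRD; last by rewrite pnatr_eq0 implybT.
  by rewrite exprMn powR_mulrn// powRrM powR_mulrn ?powR_ge0// powRrM powR_mulrn.
rewrite -(powR_mulrn m.+1)// /powR pnatr_eq0/= ltr_expR ltr_pM2r// ln_gt0// ltr1n//.
Qed.

End tails.
(** * Differentiability in quadratic mean of max-stable families *)

Theorem proposition3p2 (R : realType) (D k : nat)
    (Theta : set 'rV[R]_D) (P : 'rV[R]_D -> probability 'rV[R]_k R)
    (V := fun theta => exponent_function (P theta))
    (f := fun theta => max_stable_density (V theta))
    (hmodel : forall theta, Theta theta ->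
      [/\ simple_max_stable (P theta), has_mixed_partials (V theta) &
          is_density (P theta) (f theta)])
    (theta0 : 'rV[R]_D) (htheta0 : interior Theta theta0)
    (Theta0 : set 'rV[R]_D) (hTheta0 : open_nbhs theta0 Theta0)
    (hsub : Theta0 `<=` Theta)
    (A1 : forall theta theta', Theta0 theta -> Theta0 theta' ->
      [set z | orthant z /\ 0 < f theta z] = [set z | orthant z /\ 0 < f theta' z])
    (A2_exists : forall theta z, Theta0 theta -> orthant z ->
      differentiable (fun t => mixed_partial [set: 'I_k]%SET (V t) z) theta)
    (A2_continuous : {within Theta0 `*` orthant, continuous
      (fun p : 'rV[R]_D * 'rV[R]_k =>
         gradient (fun t => mixed_partial [set: 'I_k]%SET (V t) p.2) p.1)})
    (N : 'rV[R]_k -> R) (hN : is_norm N)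
    (A alpha : R) (hA : 0 < A) (halpha : 0 <= alpha < 1 / 2)
    (c := fun z : 'rV[R]_k => A * \sum_(i < k) z ord0 i `^ (- alpha))
    (A3_V : forall theta z, Theta0 theta -> orthant z -> N z = 1 ->
      differentiable (fun t => ln (V t z)) theta /\
      `| gradient (fun t => ln (V t z)) theta | <= c z)
    (A3_mixed : forall theta z (tau : {set 'I_k}),
      Theta0 theta -> orthant z -> N z = 1 -> tau != finset.set0 ->
      differentiable (fun t => mixed_partial tau (V t) z) theta /\
      `| (mixed_partial tau (V theta) z)^-1 *:
         gradient (fun t => mixed_partial tau (V t) z) theta | <= c z) :
  (forall z, 0 < f theta0 z -> differentiable (fun t => ln (f t z)) theta0) /\
  dqm_with_score f theta0 (fun z => gradient (fun t => ln (f t z)) theta0).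

Proof.
have [r r0 rU] : exists2 r : R, 0 < r & forall h, `|h| < r -> Theta0 (theta0 + h).
  have [oU Ut] := hTheta0.
  have /nbhs_ballP[r /= r0 hr] : nbhs theta0 Theta0 by exact: open_nbhs_nbhs.
  exists r => // h hr'; apply: hr; rewrite -ball_normE /= opprD addNKr normrN//.
have [openU Utheta0] := hTheta0.
have U0 : `|0 : 'rV[R]_D| < r by rewrite normr0.
(* In dimension [0] the density is constant in the parameter. *)
have [k0|k0] := posnP k.
  have noI (i : 'I_k) : False by case: i => j; rewrite k0.
  have Vconst t z : V t z = 0.
    rewrite /V /exponent_function /distribution_function.
    rewrite (_ : [set x | _] = setT).
      by rewrite probability_setT ln1 oppr0.
    by apply/seteqP; split => // x _ i; case: (noI i).
  have fconst t t' : f t = f t'.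
    by rewrite /f (_ : V t = V t')//; apply/funext => z; rewrite !Vconst.
  have lnconst z : (fun t => ln (f t z)) = cst (ln (f theta0 z)).
    by apply/funext => t; rewrite (fconst t theta0).
  have scoreE z : gradient (fun t => ln (f t z)) theta0 = 0.
    by apply/rowP => i; rewrite !mxE lnconst derive_cst.
  split; first by move=> z _; rewrite lnconst; exact: differentiable_cst.
  split.
    by under eq_fun do rewrite scoreE; exact: measurable_cst.
  move=> e e0; near=> h; rewrite integral0_eq; last first.
    move=> z _; rewrite scoreE (fconst (theta0 + h) theta0) trmx0 mulmx0 mxE.
    by rewrite mulr0 mul0r !subrr expr0n.
  by rewrite lee_fin mulr_ge0 ?sqr_ge0// ltW.
pose i0 : 'I_k := Ordinal k0.
have hms t : Theta0 t -> simple_max_stable (P t) by move=> /hsub/hmodel[].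
have hmp t : Theta0 t -> has_mixed_partials (V t) by move=> /hsub/hmodel[].
have hd t : Theta0 t -> is_density (P t) (f t) by move=> /hsub/hmodel[].
have alpha0 : 0 <= alpha by case/andP: halpha.
have [m hm] := exists_tail_exponent halpha.
pose K := size (index_enum {set 'I_k}).
pose S := \sum_(i < k) N (delta_mx ord0 i).
have S0 : 0 <= S by apply: sumr_ge0 => i _; exact: is_norm_ge0.
pose M := D%:R * (A * k%:R * S `^ alpha * (k%:R + K%:R)).
have M0 : 0 <= M by rewrite !mulr_ge0 ?addr_ge0 ?powR_ge0// ltW.
pose b : R := 2 * (2 ^+ m.+2) `^ alpha.
have b0 : 0 <= b by rewrite mulr_ge0// powR_ge0.
pose E n := [set z : 'rV[R]_k | forall i, (2 ^+ n)^-1 <= z ord0 i <= (2 ^+ m.+1) ^+ n].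
pose g n := M * b ^+ n.
pose q : R := k%:R * (m.+1`!%:R + 1).
pose p n := q * ((2 ^+ m.+1)^-1) ^+ n.
have p2 j : 0 < 2 ^+ j :> R by rewrite exprn_gt0.
have E_orthant n z : E n z -> orthant z.
  by move=> Ez i; have /andP[+ _] := Ez i; apply: lt_le_trans; rewrite invr_gt0.
have mE n : measurable (E n).
  apply: (measurable_row_box (A := fun=> [set u | (2 ^+ n)^-1 <= u <= (2 ^+ m.+1) ^+ n])).
  by move=> i; rewrite -set_itvcc; exact: measurable_itv.
have ndE n1 n2 : (n1 <= n2)%N -> E n1 `<=` E n2.
  move=> n12 z Ez i; have /andP[z1 z2] := Ez i; apply/andP; split.
    by apply: le_trans z1; rewrite lef_pV2 ?posrE// ler_eXn2l// ltr1n.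
  by apply: le_trans z2 _; rewrite ler_eXn2l// exprn_egt1// ltr1n.
have coverE z : orthant z -> (\bigcup_n E n) z.
  move=> z0; pose s := \sum_(i < k) ((z ord0 i)^-1 + z ord0 i).
  have s0 : 0 <= s by apply: sumr_ge0 => i _; rewrite addr_ge0 ?invr_ge0// ltW// z0.
  have /andP[_ sn] := truncn_itv s0; set n := (Num.truncn s).+1 in sn.
  have n2 : n%:R <= 2 ^+ n :> R by rewrite -natrX ler_nat ltnW// ltn_expl.
  (* Each coordinate of [z] and its inverse are at most [s < n <= 2 ^+ n]. *)
  exists n => // i; have zi := z0 i.
  have zs : (z ord0 i)^-1 + z ord0 i <= s.
    rewrite /s (bigD1 i)//= lerDl sumr_ge0// => j _.
    by rewrite addr_ge0 ?invr_ge0// ltW// z0.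
  have zi' : 0 < (z ord0 i)^-1 by rewrite invr_gt0.
  apply/andP; split.
    by rewrite -[leRHS]invrK lef_pV2 ?posrE//; lra.
  have : 2 ^+ n <= (2 ^+ m.+1) ^+ n :> R.
    by rewrite lerXn2r ?nnegrE ?(ltW (p2 _))// -[leLHS]expr1 ler_eXn2l// ltr1n.
  lra.
have f_lip n h z : E n z -> `|h| < r -> log_lip (g n) (f ^~ z) (theta0 + h).
  move=> Ez hr.
  apply: log_lip_le (log_lip_max_stable_density openU hms hmp hN hA A3_V A3_mixed i0
    (rU _ hr) (E_orthant _ _ Ez)).
  rewrite /g /M -mulrA -[leRHS]mulrA ler_wpM2l//.
  exact: angular_bound_le hN hA alpha0 i0 m.+1 n z Ez.
have foff h z : `|h| < r -> ~ (\bigcup_n E n) z -> f (theta0 + h) z = 0.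
  move=> hr nE; rewrite /f /max_stable_density patchE memNset// => zo.
  by apply: nE; exact: coverE.
have f_ge0 h z : `|h| < r -> 0 <= f (theta0 + h) z.
  by move=> /rU/hd[].
have fm h : `|h| < r -> measurable_fun [set: 'rV[R]_k] (f (theta0 + h)).
  by move=> /rU/hd[].
(* A density of the model vanishes outside of the orthant, so [A1] compares full supports. *)
have fpos h h' z : `|h| < r -> `|h'| < r -> 0 < f (theta0 + h) z -> 0 < f (theta0 + h') z.
  move=> hr h'r fz; have zo : orthant z.
    apply: contrapT => zo; move: fz.
    by rewrite /f /max_stable_density patchE memNset// ltxx.
  have : [set z | orthant z /\ 0 < f (theta0 + h) z] z by [].
  by rewrite (A1 _ (theta0 + h') (rU _ hr) (rU _ h'r)) => -[].
have fint : (\int[lebesgue_row R k]_z (f theta0 z)%:E < +oo)%E.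
  have [_ _ <-//] := hd _ Utheta0.
  by rewrite probability_setT ltry.
have ftail n h : `|h| < r ->
    (\int[lebesgue_row R k]_(z in ~` E n) (f (theta0 + h) z)%:E <= (p n)%:E)%E.
  move=> hr; have [_ _ <-] := hd _ (rU _ hr); last exact: measurableC.
  apply: le_trans (probability_outside_box_le (hms _ (rU _ hr)) _ _) _.
  - by rewrite invr_gt0.
  - by rewrite !exprn_gt0.
  rewrite lee_fin /p /q -mulrA ler_wpM2l// mulrDl mul1r exprVn lerD2r mulN1r invrK.
  apply: le_trans (expRN_le m (p2 n)) _.
  by rewrite -!exprM mulnC.
have gpsum : (\sum_(0 <= n <oo) (g n.+1 ^+ 2 * p n)%:E < +oo)%E.
  have q0 : 0 <= q by rewrite mulr_ge0// addr_ge0.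
  rewrite (eq_eseriesr (g := fun n => (M ^+ 2 * b ^+ 2 * q * (b ^+ 2 / 2 ^+ m.+1) ^+ n)%:E)).
    apply: nneseries_geometric_lty; first by rewrite mulr_ge0// mulr_ge0 ?sqr_ge0.
    by rewrite hm andbT divr_ge0 ?sqr_ge0// ltW.
  move=> n _; congr EFin; rewrite /g /p [(M * _) ^+ 2]exprMn (exprAC b) (exprS (b ^+ 2)).
  rewrite [(b ^+ 2 / _) ^+ n]exprMn.
  move: ((b ^+ 2) ^+ n) ((2 ^+ m.+1)^-1 ^+ n) => X Y; ring.
have zcase z : (exists n, E n z) \/ (\near theta0, f theta0 z = 0).
  have [[n _ Enz]|nE] := pselect ((\bigcup_n E n) z); [by left; exists n|right].
  have : \forall h \near (0 : 'rV[R]_D), `|h| < r by exact: nbhs0_lt.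
  rewrite (near_shift theta0 0); apply: filterS => t /=; rewrite sub0r => tr.
  by rewrite -(foff _ _ tr nE) addrC subrK.
have dfz z : differentiable (f ^~ z) theta0.
  case: (zcase z) => [[n Enz]|fz].
    by have [] := f_lip n 0 z Enz U0; rewrite addr0.
  apply: (@near_eq_differentiable _ _ (cst 0)); last exact: differentiable_cst.
  by apply: filterS fz => t ->.
have f00 z : 0 <= f theta0 z by have [] := hd _ Utheta0.
have near_null z : f theta0 z = 0 -> \near theta0, f theta0 z = 0.
  move=> fz0; have : \forall h \near (0 : 'rV[R]_D), `|h| < r by exact: nbhs0_lt.
  rewrite (near_shift theta0 0); apply: filterS => t /=; rewrite sub0r => tr.
  have -> : t = theta0 + (t - theta0) by rewrite addrC subrK.
  apply/eqP; rewrite eq_le f_ge0// andbT leNgt; apply/negP => ft.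
  by have := fpos _ _ _ tr U0 ft; rewrite addr0 fz0 ltxx.
(* Off the support both sides vanish: [ln 0 = 0], and division by [0] is [0]. *)
have lnE z : differentiable (fun t => ln (f t z)) theta0 /\
    forall h, 'D_h (fun t => ln (f t z)) theta0 = score_at f theta0 h z.
  have [fz|fz] := ltP 0 (f theta0 z).
    by have [dl el] := differentiable_lnE (dfz z) fz; split.
  have fz0 : f theta0 z = 0 by apply/eqP; rewrite eq_le fz f00.
  have nz : \near theta0, (cst 0 : 'rV[R]_D -> R) theta0 = ln (f theta0 z).
    by apply: filterS (near_null z fz0) => t ->; rewrite ln0.
  split; first by apply: (near_eq_differentiable nz); exact: differentiable_cst.
  by move=> h; rewrite -(near_eq_derive h nz) derive_cst /score_at fz0 invr0 mulr0.
have scoreE h z : (h *m (gradient (fun t => ln (f t z)) theta0)^T) ord0 ord0 =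
    score_at f theta0 h z.
  have [dl <-] := lnE z; rewrite derive_gradient// mxE.
  by apply: eq_bigr => i _; rewrite [in LHS]mxE.
split; first by move=> z _; have [] := lnE z.
split.
  apply: measurable_fun_row => i.
  rewrite (_ : (fun _ => _) = score_at f theta0 (delta_mx ord0 i)).
    exact: (measurable_score_at r0 fm foff f_lip f_ge0).
  by apply/funext => z; rewrite mxE; have [_ ->] := lnE z.
move=> e e0.
have g0 n : 0 <= g n by rewrite mulr_ge0// exprn_ge0.
have := qm_remainder_negligible r0 fm mE ndE foff g0 f_lip fpos f_ge0 fint ftail gpsum e0.
apply: filterS => h; apply: le_trans.
rewrite le_eqVlt; apply/orP; left; apply/eqP; apply: eq_integral => z _.
by rewrite scoreE.
Unshelve. all: by end_near. Qed.
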